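(* Let $k$ be a field and let $\mathcal A$ be a finite set of hyperplanes through the origin in $\mathbb R^d$, with face semigroup $\mathcal F$, intersection lattice $\mathcal L$ and face semigroup algebra $k\mathcal F$. The Whitney cohomology $\operatorname{WH}^*(\mathcal L^* )$ of the opposite lattice $\mathcal L^*$ is isomorphic, as a $k$-vector space, to the ideal of chambers in $k\mathcal F$ (the span of the chambers). This ideal is a projective indecomposable $k\mathcal F$-module.
   Context: For each $H\in\mathcal A$ fix a labelling $H^+,H^-$ of the two open half-spaces determined by $H$, and put $H^0=H$. A face of $\mathcal A$ is a nonempty set of the form $x=\bigcap_{H\in\mathcal A}H^{\sigma_H}$ with $\sigma_H\in\{+,-,0\}$; write $\sigma_H(x)=\sigma_H$. $\mathcal F$ is the set of faces; a chamber is a face $c$ with $\sigma_H(c)\neq0$ for all $H\in\mathcal A$. The support of a face is $\operatorname{supp}(x)=\bigcap_{H:\sigma_H(x)=0}H$ (equal to $\mathbb R^d$ if no $\sigma_H(x)$ is $0$). The intersection lattice $\mathcal L=\operatorname{supp}(\mathcal F)$ is ordered by inclusion, and $\mathcal L^*$ is the same set with the reversed order (so the bottom of $\mathcal L^*$ is $\mathbb R^d$). The product $xy$ of faces is the face with $\sigma_H(xy)=\sigma_H(x)$ if $\sigma_H(x)\ne0$ and $\sigma_H(xy)=\sigma_H(y)$ if $\sigma_H(x)=0$. This makes $\mathcal F$ a semigroup with identity $1=\bigcap_{H\in\mathcal A}H$, and $k\mathcal F$ is its semigroup algebra over $k$. Modules are left modules. Order cohomology: let $P$ be a finite poset with minimum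 $\hat0$ and maximum $\hat1$. If $P$ has at least two elements, for $i\ge0$ let $C_i(P)$ be the $k$-vector space with basis the chains $(x_0<\cdots<x_i)$ with all $x_j\in P-\{\hat0,\hat1\}$, let $C_{-1}(P)=k$ be spanned by the empty chain, and $C_i(P)=0$ for $i<-1$. If $P$ has one element let $C_{-2}(P)=k$ and $C_i(P)=0$ for $i\neq-2$. Define $\delta_i:C_i(P)\to C_{i+1}(P)$ by $\delta_i(x_0<\cdots<x_i)=\sum_{j=0}^{i+1}(-1)^j\sum_{x_{j-1}<x<x_j}(x_0<\cdots<x_{j-1}<x<x_j<\cdots<x_i)$ with $x_{-1}=\hat0$, $x_{i+1}=\hat1$. Then $H^i(P)=\ker(\delta_i)/\operatorname{im}(\delta_{i-1})$ and $H^*(P)=\bigoplus_iH^i(P)$. The Whitney cohomology of a finite poset $P$ with $\hat0$ is $\operatorname{WH}^*(P)=\bigoplus_{X\in P}H^*([\hat0,X])$. *)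

(* Defs.v *)
From HB Require Import structures.
From mathcomp Require Import all_boot all_order all_algebra.
From mathcomp Require Import finmap generic_quotient ring_quotient.
From mathcomp Require Import boolp classical_sets cardinality reals.
From mathcomp Require Import monalg.

Set Implicit Arguments.
Unset Strict Implicit.
Unset Printing Implicit Defensive.

Import Order.TTheory GRing.Theory Num.Theory.
Local Open Scope ring_scope.
Local Open Scope quotient_scope.

Section QuotientSpace.
Variables (k : fieldType) (V : vectType k) (U : {vspace V}).

Let Q := Quotient.quot U.

Definition quotv_scale (a : k) (x : Q) : Q := \pi_Q (a *: repr x).

Lemma quotv_scale_pi a (v : V) : quotv_scale a (\pi_Q v) = \pi_Q (a *: v).
Proof.
apply/eqP; rewrite -Quotient.idealrBE -scalerBr rpredZ //.
by rewrite (Quotient.idealrBE U) reprK.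
Qed.

Lemma quotv_scaleA a b (x : Q) :
  quotv_scale a (quotv_scale b x) = quotv_scale (a * b) x.
Proof. by elim/quotW: x => x; rewrite (quotv_scale_pi b) !quotv_scale_pi scalerA. Qed.

Lemma quotv_scale1 (x : Q) : quotv_scale 1 x = x.
Proof. by rewrite /quotv_scale scale1r reprK. Qed.

Lemma quotv_scaleDr a (x y : Q) :
  quotv_scale a (x + y) = quotv_scale a x + quotv_scale a y.
Proof.
elim/quotW: x => x; elim/quotW: y => y.
by rewrite -raddfD !quotv_scale_pi scalerDr raddfD.
Qed.

Lemma quotv_scaleDl (x : Q) a b :
  quotv_scale (a + b) x = quotv_scale a x + quotv_scale b x.
Proof. by elim/quotW: x => x; rewrite !quotv_scale_pi scalerDl raddfD. Qed.

Definition quotv := Q.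
HB.instance Definition _ := GRing.Zmodule.on quotv.
HB.instance Definition _ := GRing.Zmodule_isLmodule.Build k quotv
  quotv_scaleA quotv_scale1 quotv_scaleDr quotv_scaleDl.

End QuotientSpace.

(* Z / (Z :&: B); below B is contained in Z, namely B = im and Z = ker of two
   consecutive coboundary maps. *)
Definition subquotv (k : fieldType) (V : vectType k) (Z B : {vspace V}) :
    lmodType k :=
  quotv (linfun (vsval : subvs_of Z -> V) @^-1: B)%VS.

Section DirectSum.
Variables (k : pzRingType) (I : Type) (M : I -> lmodType k).

Definition dprod := forall i, M i.

HB.instance Definition _ := gen_eqMixin dprod.
HB.instance Definition _ := gen_choiceMixin dprod.

Implicit Types f g h : dprod.

Definition dprod0 : dprod := fun=> 0.
Definition dprod_add f g : dprod := fun i => f i + g i.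
Definition dprod_opp f : dprod := fun i => - f i.
Definition dprod_scale a f : dprod := fun i => a *: f i.

Lemma dprod_addA : associative dprod_add.
Proof. by move=> f g h; apply: functional_extensionality_dep => i; exact: addrA. Qed.
Lemma dprod_addC : commutative dprod_add.
Proof. by move=> f g; apply: functional_extensionality_dep => i; exact: addrC. Qed.
Lemma dprod_add0 : left_id dprod0 dprod_add.
Proof. by move=> f; apply: functional_extensionality_dep => i; exact: add0r. Qed.
Lemma dprod_addN : left_inverse dprod0 dprod_opp dprod_add.
Proof. by move=> f; apply: functional_extensionality_dep => i; exact: addNr. Qed.

HB.instance Definition _ :=
  GRing.isZmodule.Build dprod dprod_addA dprod_addC dprod_add0 dprod_addN.

Lemma dprod_scaleA a b f : dprod_scale a (dprod_scale b f) = dprod_scale (a * b) f.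
Proof. by apply: functional_extensionality_dep => i; exact: scalerA. Qed.
Lemma dprod_scale1 : left_id 1 dprod_scale.
Proof. by move=> f; apply: functional_extensionality_dep => i; exact: scale1r. Qed.
Lemma dprod_scaleDr : right_distributive dprod_scale +%R.
Proof. by move=> a f g; apply: functional_extensionality_dep => i; exact: scalerDr. Qed.
Lemma dprod_scaleDl f : {morph dprod_scale^~ f : a b / a + b}.
Proof. by move=> a b; apply: functional_extensionality_dep => i; exact: scalerDl. Qed.

HB.instance Definition _ := GRing.Zmodule_isLmodule.Build k dprod
  dprod_scaleA dprod_scale1 dprod_scaleDr dprod_scaleDl.

Definition finitely_supported : {pred dprod} :=
  [pred f : dprod | `[< finite_set [set i | f i != 0]%classic >]].

Lemma finitely_supported_submod : submod_closed finitely_supported.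
Proof.
split=> [|a f g].
  apply/asboolP; apply: (sub_finite_set _ (finite_set0 I)) => i /=.
  by rewrite eqxx.
move=> /asboolP ff /asboolP fg; apply/asboolP.
have ffg : finite_set ([set i | f i != 0] `|` [set i | g i != 0])%classic.
  by rewrite finite_setU.
apply: sub_finite_set ffg => i /=.
have [fi0|] := eqVneq (f i) 0; last by left.
have [gi0|] := eqVneq (g i) 0; last by right.
by rewrite /GRing.add /GRing.scale /= /dprod_add /dprod_scale fi0 gi0
  scaler0 addr0 eqxx.
Qed.

HB.instance Definition _ := GRing.isSubmodClosed.Build k dprod
  finitely_supported finitely_supported_submod.

Definition dsum := {f : dprod | f \in finitely_supported}.
HB.instance Definition _ := Choice.on dsum.
HB.instance Definition _ := SubType.on dsum.
HB.instance Definition _ := [SubChoice_isSubLmodule of dsum by <:].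

End DirectSum.

Definition projective (S : nzRingType) (M : lmodType S) : Prop :=
  forall (U V : lmodType S) (g : {linear U -> V}) (f : {linear M -> V}),
    (forall v, exists u, g u = v) ->
    exists h : {linear M -> U}, forall m, g (h m) = f m.

Definition indecomposable (S : nzRingType) (M : lmodType S) : Prop :=
  (exists m : M, m != 0) /\
  forall U V : submodClosed M,
    (forall m, exists u v, [/\ u \in U, v \in V & m = u + v]) ->
    (forall m, m \in U -> m \in V -> m = 0) ->
    (forall m, m \in U -> m = 0) \/ (forall m, m \in V -> m = 0).

Section OrderCohomology.
Variables (k : fieldType) (disp : Order.disp_t) (P : finTBPOrderType disp).

(* The basis of C_i(P); the second branch is the case of a one-element P, where
   the only basis vector, in degree -2, is encoded by the empty sequence. *)
Definition is_chain (i : int) (s : seq P) : bool :=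
  if (1 < #|P|)%N then
    [&& ((size s)%:Z == i + 1), sorted (fun x y => (x < y)%O) s
      & all (fun x => (x != \bot%O) && (x != \top%O)) s]
  else (i == -2) && nilp s.

(* A strict chain of P has at most #|P| elements, so the bound is harmless. *)
Definition chain (i : int) := {s : #|P|.-bseq P | is_chain i s}.

Definition cochain (i : int) : vectType k := {ffun chain i -> k^o}.

(* The basis vector at s, or 0 if s is not a chain of degree i. *)
Definition chain_vect (i : int) (s : seq P) : cochain i :=
  [ffun c : chain i => ((val c : seq P) == s)%:R].

(* With x = (x_0 < ... < x_i), x_(-1) = \bot and x_(i+1) = \top, the element
   x_(j-1) is nth \top (\bot :: x) j and x_j is nth \top x j. *)
Definition coboundary_chain (i' : int) (x : seq P) : cochain i' :=
  \sum_(j < (size x).+1) (-1) ^+ j *: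
    \sum_(y : P | (nth \top (\bot :: x) j < y < nth \top x j)%O)
      chain_vect i' (take j x ++ y :: drop j x).

(* The target degree i' is a separate argument only because i - 1 + 1 is not
   convertible to i; the map is delta_i when i' = i + 1. *)
Definition coboundary_fun (i i' : int) (f : cochain i) : cochain i' :=
  \sum_(c : chain i) f c *: coboundary_chain i' (val c : seq P).

Lemma coboundary_fun_linear i i' : linear (@coboundary_fun i i').
Proof.
move=> a f g; rewrite /coboundary_fun scaler_sumr -big_split /=.
by apply: eq_bigr => c _; rewrite !ffunE scalerDl scalerA.
Qed.

HB.instance Definition _ i i' := GRing.isLinear.Build k (cochain i) (cochain i')
  *:%R (@coboundary_fun i i') (@coboundary_fun_linear i i').

Definition coboundary (i i' : int) : 'Hom(cochain i, cochain i') :=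
  linfun (@coboundary_fun i i').

Definition order_cohomology (i : int) : lmodType k :=
  subquotv (lker (coboundary i (i + 1))) (limg (coboundary (i - 1) i)).

Definition total_cohomology : lmodType k := dsum order_cohomology.

End OrderCohomology.

Section LowerInterval.
Variables (disp : Order.disp_t) (P : finBPOrderType disp) (X : P).

Definition lower := {Y : P | (Y <= X)%O}.
HB.instance Definition _ := SubType.on lower.
HB.instance Definition _ := Finite.on lower.
HB.instance Definition _ := [SubChoice_isSubPOrder of lower by <: with disp].

Definition lower_bot : lower := exist _ \bot%O (le0x X).
Definition lower_top : lower := exist _ X (lexx X).

Lemma lower_le0x (Y : lower) : (lower_bot <= Y)%O.
Proof. exact: le0x. Qed.
Lemma lower_lex1 (Y : lower) : (Y <= lower_top)%O.
Proof. exact: (valP Y). Qed.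

HB.instance Definition _ := Order.hasBottom.Build disp lower lower_le0x.
HB.instance Definition _ := Order.hasTop.Build disp lower lower_lex1.

End LowerInterval.

Definition whitney_cohomology (k : fieldType) (disp : Order.disp_t)
    (P : finBPOrderType disp) : lmodType k :=
  dsum (fun X : P => total_cohomology k (lower X)).

Inductive sign := Pos | Neg | Zero.

Definition sign_code (s : sign) : option bool :=
  match s with Pos => Some true | Neg => Some false | Zero => None end.
Definition sign_decode (o : option bool) : sign :=
  match o with Some true => Pos | Some false => Neg | None => Zero end.
Lemma sign_codeK : cancel sign_code sign_decode. Proof. by case. Qed.
HB.instance Definition _ := Finite.copy sign (can_type sign_codeK).

Definition sign_mul (s t : sign) : sign := if s is Zero then t else s.

(* A labelling of the two half-spaces of H is given by a linear form with
   kernel H, whose sign tells the half-spaces apart. *)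
Record arrangement (R : realType) (d : nat) := Arrangement {
  hyperplanes : {fset {vspace 'rV[R]_d}};
  form : hyperplanes -> 'Hom('rV[R]_d, R^o);
  dim_hyperplane : forall H : hyperplanes, (\dim (val H)).+1 = d;
  lker_form : forall H : hyperplanes, lker (form H) = val H }.

Section Arrangement.
Variables (R : realType) (d : nat) (A : arrangement R d).
Implicit Types (H : hyperplanes A) (s t : {ffun hyperplanes A -> sign}).

Definition halfspace H (s : sign) : set 'rV[R]_d :=
  match s with
  | Pos => [set v | 0 < (form H v : R)]%classic
  | Neg => [set v | (form H v : R) < 0]%classic
  | Zero => [set v | v \in val H]%classic
  end.

Definition cell s : set 'rV[R]_d :=
  (\bigcap_(H in [set: hyperplanes A]) halfspace H (s H))%classic.

(* A face is represented by its sign vector, which it determines by cell_inj. *)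
Definition face := {s : {ffun hyperplanes A -> sign} | `[< cell s !=set0 >]%classic}.
HB.instance Definition _ := SubType.on face.
HB.instance Definition _ := Finite.on face.

Definition fsign (x : face) H : sign := val x H.

Definition is_chamber (x : face) : bool := [forall H, fsign x H != Zero].

Definition sign_of (r : R) : sign :=
  if r == 0 then Zero else if 0 < r then Pos else Neg.

Lemma halfspaceE H u v : halfspace H u v <-> sign_of (form H v) = u.
Proof.
rewrite /sign_of; case: u => /=.
- by case: ltrgt0P => //.
- by case: ltrgt0P => //.
- by rewrite -lker_form memv_ker; case: eqP => // _; case: ifP.
Qed.

Lemma cellE s v : cell s v <-> forall H, sign_of (form H v) = s H.
Proof.
split=> sv H; first by apply/halfspaceE; exact: sv.
by move=> _; apply/halfspaceE.
Qed.

Lemma cell_inj s t : (cell s !=set0)%classic -> cell s = cell t -> s = t.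
Proof.
move=> [v sv] st; apply/ffunP => H.
by have /cellE <- := sv; move: sv; rewrite st => /cellE.
Qed.

Lemma face1_subproof : `[< cell [ffun=> Zero] !=set0 >]%classic.
Proof.
by apply/asboolP; exists 0 => H _ /=; rewrite ffunE /= mem0v.
Qed.
Definition face1 : face := Sub [ffun=> Zero] face1_subproof.

Lemma sign_of_perturb (H : hyperplanes A) (v w : 'rV[R]_d) (e : R) : 0 < e ->
    (form H v != 0 -> e * `|form H w : R| < `|form H v : R|) ->
  sign_of (form H (v + e *: w)) = sign_mul (sign_of (form H v)) (sign_of (form H w)).
Proof.
move=> e0; rewrite linearD linearZ /=.
set a : R := form H v; set b : R := form H w.
rewrite (_ : form H v + e *: form H w = a + e * b :> R) // -/a => ab.
rewrite /sign_of; have [a0|a0] := eqVneq a 0.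
  by rewrite a0 add0r mulf_eq0 gt_eqF //= pmulr_rgt0.
move: (ab a0); rewrite -{1}(gtr0_norm e0) -normrM; clear ab.
have [a_gt0|a_le0] := ltP 0 a.
  rewrite (gtr0_norm a_gt0) ltr_norml => /andP[h _].
  have p : 0 < a + e * b by rewrite -ltrBlDl sub0r.
  by rewrite gt_eqF // p.
have a_lt0 : a < 0 by rewrite lt_neqAle a0.
rewrite (ltr0_norm a_lt0) ltr_norml => /andP[_ h].
have p : a + e * b < 0 by rewrite -ltrBrDl sub0r.
by rewrite lt_eqF // ltNge (ltW p).
Qed.

Lemma face_mul_subproof (x y : face) :
  `[< cell [ffun H => sign_mul (fsign x H) (fsign y H)] !=set0 >]%classic.
Proof.
have /asboolP[v /cellE xv] := valP x; have /asboolP[w /cellE yw] := valP y.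
pose q H : R := `|form H v : R| / (1 + `|form H w : R|).
pose e : R := \big[Num.min/1]_(H | form H v != 0) q H.
have w1 H : 0 < 1 + `|form H w : R| by rewrite ltr_pwDl.
have e0 : 0 < e.
  rewrite /e; elim/big_ind: _ => // [a b a0 b0|H vH]; first by rewrite lt_min a0.
  by rewrite divr_gt0 // normr_gt0.
apply/asboolP; exists (v + e *: w); apply/cellE => H.
rewrite ffunE /fsign -xv -yw; apply: sign_of_perturb => // vH.
have : e <= q H by rewrite /e (bigD1 H) //= ge_min lexx.
rewrite ler_pdivlMr // mulrDr mulr1; apply: lt_le_trans.
by rewrite ltrDr.
Qed.

Definition face_mul (x y : face) : face :=
  Sub [ffun H => sign_mul (fsign x H) (fsign y H)] (face_mul_subproof x y).

Lemma fsign_mul x y H : fsign (face_mul x y) H = sign_mul (fsign x H) (fsign y H).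
Proof. by rewrite /fsign SubK ffunE. Qed.

Lemma fsign1 H : fsign face1 H = Zero.
Proof. by rewrite /fsign SubK ffunE. Qed.

Lemma faceP (x y : face) : (forall H, fsign x H = fsign y H) -> x = y.
Proof. by move=> xy; apply: val_inj; apply/ffunP. Qed.

Lemma face_mulA : associative face_mul.
Proof.
by move=> x y z; apply: faceP => H; rewrite !fsign_mul; case: (fsign x H).
Qed.

Lemma face_mul1 : left_id face1 face_mul.
Proof. by move=> x; apply: faceP => H; rewrite fsign_mul fsign1. Qed.

Lemma face_mulr1 : right_id face1 face_mul.
Proof.
by move=> x; apply: faceP => H; rewrite fsign_mul fsign1; case: (fsign x H).
Qed.

Lemma face_mul_eq1 (x y : face) : face_mul x y = face1 -> x = face1 /\ y = face1.
Proof.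
move=> xy; suff h H : fsign x H = Zero /\ fsign y H = Zero.
  by split; apply: faceP => H; rewrite fsign1; case: (h H).
by have := fsign_mul x y H; rewrite xy fsign1; case: (fsign x H).
Qed.

HB.instance Definition _ :=
  Choice_isMonomialDef.Build face face_mulA face_mul1 face_mulr1 face_mul_eq1.

Definition supp (x : face) : {vspace 'rV[R]_d} :=
  (\bigcap_(H | fsign x H == Zero) val H)%VS.

Definition lattice := seq_sub (codom supp).
HB.instance Definition _ := SubType.on lattice.
HB.instance Definition _ := Finite.on lattice.

Definition lattice_le (X Y : lattice) : bool := (val X <= val Y)%VS.

Lemma lattice_le_refl : reflexive lattice_le.
Proof. by move=> X; exact: subvv. Qed.
Lemma lattice_le_anti : antisymmetric lattice_le.
Proof. by move=> X Y XY; apply: val_inj; apply/eqP; rewrite eqEsubv. Qed.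
Lemma lattice_le_trans : transitive lattice_le.
Proof. by move=> Y X Z; exact: subv_trans. Qed.

Fact lattice_display : Order.disp_t. Proof. exact: Order.Disp tt tt. Qed.

HB.instance Definition _ := Order.Le_isPOrder.Build lattice_display lattice
  lattice_le_refl lattice_le_anti lattice_le_trans.

Definition flat_of (x : face) : lattice := SeqSub (codom_f supp x).

Lemma exists_chamber : exists c, is_chamber c.
Proof.
suff [c hc] : exists c, forall H, H \in enum {: hyperplanes A} -> fsign c H != Zero.
  by exists c; apply/forallP => H; apply: hc; rewrite mem_enum.
elim: (enum _) => [|H r [c hc]]; first by exists face1.
have [v vH] : exists v, form H v != 0.
  have : ~~ (fullv <= val H)%VS.
    apply/negP => /dimvS; rewrite dimvf leqNgt.
    by rewrite -ltnS (dim_hyperplane H) /dim /= mul1n ltnSn.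
  by move=> /subvPn[v _]; rewrite -lker_form memv_ker; exists v.
have [x xv] : exists x : face, forall H', fsign x H' = sign_of (form H' v).
  have fv : `[< cell [ffun H' => sign_of (form H' v)] !=set0 >]%classic.
    by apply/asboolP; exists v; apply/cellE => H'; rewrite ffunE.
  by exists (Sub [ffun H' => sign_of (form H' v)] fv) => H'; rewrite /fsign ffunE.
exists (face_mul c x) => H'; rewrite inE fsign_mul => /orP[/eqP->|/hc].
  case: (fsign c H) => //=; rewrite xv /sign_of (negPf vH).
  by case: ifP.
by case: (fsign c H').
Qed.

Definition lattice_bot : lattice := flat_of face1.
Definition lattice_top : lattice := flat_of (xchoose exists_chamber).

Lemma lattice_le0x (X : lattice) : (lattice_bot <= X)%O.
Proof.
have /codomP[x xE] := valP X; rewrite /Order.le /= /lattice_le xE /=.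
by apply/subv_bigcapP => H _; apply: bigcapv_inf (subvv _); rewrite fsign1.
Qed.

Lemma supp_chamber c : is_chamber c -> supp c = fullv.
Proof. by move=> /forallP cc; apply: big1 => H; rewrite (negPf (cc H)). Qed.

Lemma lattice_lex1 (X : lattice) : (X <= lattice_top)%O.
Proof.
by rewrite /Order.le /= /lattice_le /= supp_chamber ?subvf //; exact: xchooseP.
Qed.

HB.instance Definition _ :=
  Order.hasBottom.Build lattice_display lattice lattice_le0x.
HB.instance Definition _ :=
  Order.hasTop.Build lattice_display lattice lattice_lex1.

End Arrangement.

Section ChamberIdeal.
Variables (k : fieldType) (R : realType) (d : nat) (A : arrangement R d).
Implicit Types a b : {malg k[face A]}.

Definition chamber_ideal : {pred {malg k[face A]}} :=
  [pred a | `[< exists z : face A -> k,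
                  a = \sum_(c | is_chamber c) z c *: << c >> >]].

Lemma chamber_idealP a :
  reflect (forall x, ~~ is_chamber x -> a@_x = 0) (a \in chamber_ideal).
Proof.
apply: (iffP (asboolP _)) => [[z ->] x xc|ac].
  rewrite raddf_sum big1 //= => c cc; rewrite mcoeffZ mcoeffU.
  by case: eqP => [cx|]; rewrite ?mulr0 // -cx cc in xc *.
exists (fun c => a@_c); apply/malgP => x; rewrite raddf_sum /=.
under eq_bigr do rewrite mcoeffZ mcoeffU.
have [xc|xc] := boolP (is_chamber x); last first.
  rewrite ac // big1 // => c cc; case: eqP => [cx|]; rewrite ?mulr0 //.
  by rewrite -cx cc in xc.
rewrite (bigD1 x) //= eqxx mulr1 big1 ?addr0 // => c /andP[_ /negPf->].
by rewrite mulr0.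
Qed.

Lemma is_chamber_mull (x c : face A) : is_chamber c -> is_chamber (face_mul x c).
Proof.
move=> /forallP cc; apply/forallP => H; rewrite fsign_mul.
by case: (fsign x H) (cc H).
Qed.

Lemma is_chamber_mulr (x c : face A) : is_chamber c -> is_chamber (face_mul c x).
Proof.
move=> /forallP cc; apply/forallP => H; rewrite fsign_mul.
by case: (fsign c H) (cc H).
Qed.

Lemma chamber_ideal_mull a b : b \in chamber_ideal -> a * b \in chamber_ideal.
Proof.
move=> /chamber_idealP bc; apply/chamber_idealP => x xc.
rewrite mcoeffMl big1 // => y _; rewrite big1 // => z _.
case: eqP => [xyz|]; rewrite ?mulr0n //.
have [zc|/bc->] := boolP (is_chamber z); last by rewrite mulr0 mul0rn.
by rewrite -xyz is_chamber_mull in xc.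
Qed.

Lemma chamber_ideal_mulr a b : b \in chamber_ideal -> b * a \in chamber_ideal.
Proof.
move=> /chamber_idealP bc; apply/chamber_idealP => x xc.
rewrite mcoeffMl big1 // => y _; rewrite big1 // => z _.
case: eqP => [xyz|]; rewrite ?mulr0n //.
have [yc|/bc->] := boolP (is_chamber y); last by rewrite mul0r mul0rn.
by rewrite -xyz is_chamber_mulr in xc.
Qed.

Lemma chamber_ideal_addr : addr_closed chamber_ideal.
Proof.
split=> [|a b /chamber_idealP ac /chamber_idealP bc]; apply/chamber_idealP => x xc.
  by rewrite raddf0.
by rewrite raddfD /= ac ?bc ?addr0.
Qed.

Lemma chamber_ideal_submod : submod_closed chamber_ideal.
Proof.
split; first exact: chamber_ideal_addr.1.
move=> z a b aI bI; apply: chamber_ideal_addr.2 => //.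
by rewrite -mul_malgC chamber_ideal_mull.
Qed.

HB.instance Definition _ := GRing.isSubmodClosed.Build k {malg k[face A]}
  chamber_ideal chamber_ideal_submod.

(* The same subset is needed as a k-vector space and as a left module over the
   algebra; the two scalings live on distinct types, as for R and R^o. *)
Definition chamber_space := {a : {malg k[face A]} | a \in chamber_ideal}.
HB.instance Definition _ := Choice.on chamber_space.
HB.instance Definition _ := SubType.on chamber_space.
HB.instance Definition _ := [SubChoice_isSubLmodule of chamber_space by <:].

Definition chamber_submod : {pred {malg k[face A]}^o} := chamber_ideal.

Lemma chamber_submod_closed : submod_closed chamber_submod.
Proof.
split; first exact: chamber_ideal_addr.1.
by move=> z a b aI bI; apply: chamber_ideal_addr.2 => //; exact: chamber_ideal_mull.
Qed.

HB.instance Definition _ := GRing.isSubmodClosed.Build {malg k[face A]}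
  {malg k[face A]}^o chamber_submod chamber_submod_closed.

Definition chamber_module := {a : {malg k[face A]}^o | a \in chamber_submod}.
HB.instance Definition _ := Choice.on chamber_module.
HB.instance Definition _ := SubType.on chamber_module.
HB.instance Definition _ := [SubChoice_isSubLmodule of chamber_module by <:].

End ChamberIdeal.

(* Main.v *)
From HB Require Import structures.
From mathcomp Require Import finmap generic_quotient ring_quotient.
From mathcomp Require Import boolp classical_sets cardinality reals monalg.
From mathcomp Require Import all_boot all_order all_algebra.
From mathcomp Require Import zify ring lra.
Require Import Defs.

(** Both spaces are finite-dimensional, so the first claim is an equality of
    dimensions: the total Betti numbers h(X) of the intervals [0, X] of the
    opposite lattice must add up to the number of chambers.

    All the cochains of [0, X] together form one space with a basis indexed by
    the chains strictly between 0 and X, on which the coboundary squares to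
    zero; hence h(X) is the number of these chains minus twice the rank
    ([chain_betti], [has_dim_total_cohomology]).  The numbers h(X) satisfy a
    recursion ([chain_betti_complements]).  Fix a hyperplane a containing X.
    For X = a the recursion below reads h(a) = h(0) and is immediate.  Otherwise
    the chains that avoid every flat Y with a not containing Y and Y cap a = X
    form an exact complex, since Y |-> Y cap a contracts what is left onto a.
    By semimodularity such a Y is a coatom of [0, X], so each remaining chain
    contains exactly one Y, as its largest element, and the rest of it is a
    chain of the open interval (0, Y).  Therefore

      h(X) = sum of h(Y) over the Y with Y cap a = X and Y not inside a.

    The chambers are counted by adding the hyperplanes one at a time: a new
    hyperplane l cuts exactly those regions that meet l, and these are the
    regions of the restriction to l ([card_patterns_cons]).  Unfolding this
    deletion-restriction rule distributes the chambers over the flats, the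
    share of X being the number of sets of hyperplanes that contain no broken
    circuit and meet in X ([nbc]).  Taking for a the last hyperplane that
    contains X, these shares obey the recursion of h ([nbc_last]), so they
    agree with h ([chain_betti_nbc]).

    The statements about modules rest on the identities c x = c for a chamber c
    and any face x.  They say that c is an idempotent, that the ideal I of
    chambers is the left ideal generated by c, and that c I is the line spanned
    by c.  So I is a direct summand of the algebra, hence projective, and in a
    decomposition of I one summand contains a nonzero multiple of c, hence c,
    hence everything. *)
Set Implicit Arguments.
Unset Strict Implicit.
Unset Printing Implicit Defensive.

Import Order.TTheory GRing.Theory Num.Theory.
Local Open Scope ring_scope.
Local Open Scope quotient_scope.

(** * Modules of finite dimension *)

Section Dimension.
Variable k : fieldType.

(** Coordinates are functions on nat that vanish from n on, instead of vectors
    of length n, so that the coordinates of a family of modules of varying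
    dimensions have one common type. *)
Definition has_dim (M : lmodType k) (n : nat) : Prop :=
  exists f : M -> nat -> k,
    [/\ forall a u v j, f (a *: u + v) j = a * f u j + f v j,
        forall u, (forall j, f u j = 0) -> u = 0,
        forall u j, (n <= j)%N -> f u j = 0
      & forall phi, (forall j, (n <= j)%N -> phi j = 0) ->
          exists u, forall j, f u j = phi j].

Lemma onth_nthE (J : Type) (x : J) (s : seq J) j :
  onth s j = if (j < size s)%N then Some (nth x s j) else None.
Proof. by elim: s j => [|y s IHs] [|j] //=; rewrite IHs. Qed.

(** Numbering the list transports a basis indexed by arbitrary objects, such as
    chambers or pairs, to the standard index set. *)
Lemma has_dim_coords (M : lmodType k) (J : eqType) (s : seq J)
    (f : M -> J -> k) :
    uniq s ->
    (forall a u v j, f (a *: u + v) j = a * f u j + f v j) ->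
    (forall u, (forall j, j \in s -> f u j = 0) -> u = 0) ->
    (forall phi : J -> k, exists u, forall j, j \in s -> f u j = phi j) ->
  has_dim M (size s).
Proof.
move=> us flin finj fsurj.
exists (fun u j => if onth s j is Some x then f u x else 0); split.
- by move=> a u v j; case: onth => [x|]; rewrite ?flin // mulr0 addr0.
- move=> u u0; apply: finj => x xs; have := u0 (index x s).
  by rewrite (onth_nthE x) /= index_mem xs nth_index.
- move=> u j; case: s us finj fsurj => [|x s] us finj fsurj.
    by rewrite onth0n.
  by move=> sj; rewrite (onth_nthE x) /= ltnNge sj.
- move=> phi phi0; have [u uE] := fsurj (fun x => phi (index x s)).
  exists u => j; have [js|js] := ltnP j (size s); last first.
    by rewrite onth_default ?phi0.
  case: s us finj fsurj uE js {phi0} => // x s us _ _ uE js.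
  by rewrite (onth_nthE x) /= js uE ?mem_nth // index_uniq.
Qed.

Lemma has_dim_iso (M N : lmodType k) n :
  has_dim M n -> has_dim N n -> exists f : {linear M -> N}, bijective f.
Proof.
move=> [f [flin finj fsupp fsurj]] [g [glin ginj gsupp gsurj]].
have flinB u v j : f (u - v) j = f u j - f v j.
  by rewrite addrC -scaleN1r flin mulN1r addrC.
have glinB u v j : g (u - v) j = g u j - g v j.
  by rewrite addrC -scaleN1r glin mulN1r addrC.
have fI u v : (forall j, f u j = f v j) -> u = v.
  by move=> uv; apply/subr0_eq/finj => j; rewrite flinB uv subrr.
have gI u v : (forall j, g u j = g v j) -> u = v.
  by move=> uv; apply/subr0_eq/ginj => j; rewrite glinB uv subrr.
have [F FE] := choice (fun u => gsurj (f u) (fsupp u)).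
have [G GE] := choice (fun u => fsurj (g u) (gsupp u)).
have Flin : linear F.
  by move=> a u v; apply: gI => j; rewrite glin !FE flin.
pose FL := GRing.isLinear.Build k M N *:%R F Flin.
pose FH : {linear M -> N} := HB.pack F FL.
exists FH; exists G => u /=; first by apply: fI => j; rewrite GE FE.
by apply: gI => j; rewrite FE GE.
Qed.

(** The index type may be infinite: cohomological degrees range over all the
    integers, but the summands vanish outside the list s. *)
Lemma has_dim_dsum (I : eqType) (M : I -> lmodType k) (n : I -> nat) (s : seq I) :
    uniq s -> (forall i, has_dim (M i) (n i)) ->
    (forall i, i \notin s -> n i = 0%N) ->
  has_dim (dsum M) (\sum_(i <- s) n i).
Proof.
move=> us Mn n0.
have {Mn} [f fP] : exists f : forall i, M i -> nat -> k, forall i,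
    [/\ forall a u v j, f i (a *: u + v) j = a * f i u j + f i v j,
        forall u, (forall j, f i u j = 0) -> u = 0,
        forall u j, (n i <= j)%N -> f i u j = 0
      & forall phi, (forall j, (n i <= j)%N -> phi j = 0) ->
          exists u, forall j, f i u j = phi j].
  exists (fun i => proj1_sig (cid (Mn i))) => i.
  exact: proj2_sig (cid (Mn i)).
pose J := [seq (i, j) | i <- s, j <- iota 0 (n i)].
have memJ i j : ((i, j) \in J) = (j < n i)%N.
  apply/allpairsPdep/idP => [[i' [j' [_]]]|ji].
    by rewrite mem_iota /= add0n => ? [-> ->].
  exists i, j; split; rewrite ?mem_iota //.
  by apply: contraLR ji => /n0 ->.
have -> : (\sum_(i <- s) n i)%N = size J.
  rewrite size_allpairs_dep sumnE big_map.
  by apply: eq_bigr => i _; rewrite size_iota.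
apply: (@has_dim_coords _ _ _ (fun (u : dsum M) ij =>
  f ij.1 ((val u : dprod M) ij.1) ij.2)).
- apply: allpairs_uniq_dep => // [i _|[i j] [i' j'] _ _ /= [-> ->] //].
  exact: iota_uniq.
- by move=> a u v [i j] /=; case: (fP i) => <-.
- move=> u u0; apply: val_inj; apply: functional_extensionality_dep => i /=.
  have [_ finj fsupp _] := fP i; apply: finj => j.
  have [/fsupp->//|ji] := leqP (n i) j.
  by apply: (u0 (i, j)); rewrite memJ.
- move=> phi.
  have /(_ _)/cid ui i : exists v : M i, forall j,
      f i v j = if (j < n i)%N then phi (i, j) else 0.
    have [_ _ _ fsurj] := fP i; apply: fsurj => j.
    by rewrite leqNgt; case: ifP.
  pose u : dprod M := fun i => sval (ui i).
  have uf : u \in finitely_supported (M:=M).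
    apply/asboolP; apply: (@sub_finite_set _ _ [set` s]%classic); last exact: finite_seq.
    move=> i /= ui0; apply: contraNT ui0 => /n0 ni0.
    have [_ finj _ _] := fP i; apply/eqP/finj => j.
    by rewrite /u (proj2_sig (ui i)) ni0.
  exists (exist _ u uf) => -[i j]; rewrite memJ /= => ji.
  by rewrite /u (proj2_sig (ui i)) ji.
Qed.

(** Projecting along U identifies the quotient by U with the complement U^C,
    whose basis provides the coordinates. *)
Lemma has_dim_quotv (V : vectType k) (U : {vspace V}) :
  has_dim (quotv U) (\dim {:V} - \dim U).
Proof.
rewrite -dimv_compl -(size_enum_ord (\dim _)).
pose p v : V := v - projv U v.
have plin a u v : p (a *: u + v) = a *: p u + p v.
  by rewrite /p linearP scalerBr opprD addrACA.
have pC v : p v \in (U^C)%VS by exact: memv_projC.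
have p0 v : (p v == 0) = (v \in U).
  rewrite subr_eq0; apply/eqP/idP => [->|vU]; first exact: memv_proj.
  by rewrite projv_id.
have reprP (v : V) : p (repr (\pi_(Quotient.quot U) v)) = p v.
  have pB u w : p (u - w) = p u - p w.
    by rewrite /p linearB opprB !opprD opprK /= [projv U w - _]addrC addrACA.
  apply/eqP; rewrite -subr_eq0 -pB p0.
  by rewrite (Quotient.idealrBE U) reprK.
pose b := vbasis (U^C)%VS.
apply: (@has_dim_coords _ _ _ (fun (x : quotv U) j => coord b j (p (repr x)))).
- exact: enum_uniq.
- move=> a; elim/quotW => u; elim/quotW => v j.
  have -> : a *: (\pi_(Quotient.quot U) u : quotv U) + \pi_(Quotient.quot U) v
            = \pi_(Quotient.quot U) (a *: u + v).
    by rewrite raddfD /= -quotv_scale_pi.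
  by rewrite !reprP plin linearP.
- elim/quotW => u u0; have : p u = 0.
    rewrite (coord_vbasis (pC u)) big1 // => j _.
    by have := u0 j (mem_enum _ _); rewrite reprP => ->; rewrite scale0r.
  move=> /eqP; rewrite p0 => uU; apply/eqP.
  rewrite -[X in _ == X](raddf0 (\pi_(Quotient.quot U))).
  by rewrite -Quotient.idealrBE subr0.
- move=> phi; pose v := \sum_j phi j *: b`_j.
  have vC : v \in (U^C)%VS.
    by apply: rpred_sum => j _; apply/rpredZ/vbasis_mem/mem_nth; rewrite size_tuple.
  exists (\pi_(Quotient.quot U) v) => j _; rewrite reprP.
  have -> : p v = v.
    by move: vC; rewrite -lker_proj memv_ker /p => /eqP->; rewrite subr0.
  by rewrite coord_sum_free // (basis_free (vbasisP _)).
Qed.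

Lemma has_dim_subquotv (V : vectType k) (Z B : {vspace V}) :
  has_dim (subquotv Z B) (\dim Z - \dim (Z :&: B)).
Proof.
set f := linfun (vsval : subvs_of Z -> V).
have fE u : f u = vsval u by rewrite lfunE.
have kerf : lker f = 0%VS.
  apply/eqP; rewrite -subv0; apply/subvP => u; rewrite memv_ker fE memv0.
  by move=> /eqP u0; apply/eqP/val_inj.
have fimg : limg f = Z.
  apply/vspaceP => v; apply/memv_imgP/idP => [[u _ ->]|vZ].
    by rewrite fE subvsP.
  by exists (Subvs vZ); rewrite ?memvf // fE.
have -> : \dim Z = \dim {:subvs_of Z}.
  by rewrite -[in LHS]fimg limg_dim_eq // kerf capv0.
have -> : \dim (Z :&: B) = \dim (f @^-1: B).
  have BZ : (Z :&: B <= limg f)%VS by rewrite fimg capvSl.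
  rewrite -lpreim_cap_limg fimg (capvC B) -[in LHS](lpreimK BZ).
  by rewrite limg_dim_eq // kerf capv0.
exact: has_dim_quotv.
Qed.

End Dimension.

(** * Ranks of based linear maps *)

Lemma sum_setU (V : nmodType) (I : finType) (A B : {set I}) (F : I -> V) :
    [disjoint A & B] ->
  \sum_(i in A :|: B) F i = \sum_(i in A) F i + \sum_(i in B) F i.
Proof.
by move=> AB; rewrite -bigU //; apply: eq_bigl => i; rewrite !inE.
Qed.

Section KernelMap.
Variables (k : fieldType) (I J : finType) (d : I -> J -> k).
Variables (S : {set I}) (T : {set J}).

(** The linear map with matrix d, cut down to the rows in S and the columns in
    T.  Complexes with different bases thus live on the same function space,
    and passing to a subcomplex or a quotient is a change of S and T. *)
Definition kernel_fun (f : {ffun J -> k^o}) : {ffun I -> k^o} :=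
  [ffun i => if i \in S then \sum_(j in T) d i j * f j else 0].

Lemma kernel_fun_linear : linear kernel_fun.
Proof.
move=> a f g; apply/ffunP => i; rewrite !ffunE; case: ifP => _; last first.
  by rewrite scaler0 addr0.
rewrite scaler_sumr -big_split; apply: eq_bigr => j _ /=.
by rewrite !ffunE mulrDr mulrCA.
Qed.

HB.instance Definition _ := GRing.isLinear.Build k {ffun J -> k^o}
  {ffun I -> k^o} *:%R kernel_fun kernel_fun_linear.

Definition kmap : 'Hom({ffun J -> k^o}, {ffun I -> k^o}) := linfun kernel_fun.

Definition rk : nat := \dim (limg kmap).

Lemma kmapE f i :
  kmap f i = if i \in S then \sum_(j in T) d i j * f j else 0.
Proof. by rewrite lfunE /= ffunE. Qed.

End KernelMap.

Section KernelRank.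
Variable k : fieldType.

Lemma eq_kmap (I J : finType) (d d' : I -> J -> k) (S S' : {set I})
    (T T' : {set J}) :
    (forall i j, (if (i \in S) && (j \in T) then d i j else 0) =
                 (if (i \in S') && (j \in T') then d' i j else 0)) ->
  kmap d S T = kmap d' S' T'.
Proof.
move=> dd; apply/lfunP => f; apply/ffunP => i; rewrite !kmapE.
have aux (d0 : I -> J -> k) S0 T0 : (if i \in S0 then \sum_(j in T0) d0 i j * f j else 0)
    = \sum_j (if (i \in S0) && (j \in T0) then d0 i j else 0) * f j :> k^o.
  case: ifP => _ /=; last by rewrite big1 // => j _; rewrite mul0r.
  by rewrite big_mkcond; apply: eq_bigr => j _; case: ifP; rewrite ?mul0r.
by rewrite !aux; apply: eq_bigr => j _; rewrite dd.
Qed.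

Lemma eq_kmap_arg (I J : finType) (d : I -> J -> k) (S : {set I}) (T : {set J})
    (f g : {ffun J -> k^o}) :
  {in T, f =1 g} -> kmap d S T f = kmap d S T g.
Proof.
move=> fg; apply/ffunP => i; rewrite !kmapE; case: ifP => // _.
by apply: eq_bigr => j jT; rewrite fg.
Qed.

Definition restriction (I : finType) (S : {set I}) :=
  kmap (fun i j => (i == j)%:R : k) S S.

Lemma restrictionE (I : finType) (S : {set I}) f i :
  restriction S f i = if i \in S then f i else 0.
Proof.
rewrite kmapE; case: ifP => // iS; rewrite (bigD1 i) //= eqxx mul1r big1 ?addr0 //.
by move=> j /andP[_ /negPf]; rewrite eq_sym => ->; rewrite mul0r.
Qed.

Lemma rk_factor (I J I' J' : finType) (d : I -> J -> k) (d' : I' -> J' -> k)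
    (S : {set I}) (T : {set J}) (S' : {set I'}) (T' : {set J'})
    (f : 'Hom({ffun I -> k^o}, {ffun I' -> k^o}))
    (g : 'Hom({ffun J' -> k^o}, {ffun J -> k^o})) :
    (kmap d' S' T' = f \o (kmap d S T \o g))%VF ->
  (rk d' S' T' <= rk d S T)%N.
Proof.
move=> dE; rewrite /rk dE !limg_comp.
have := limg_ker_dim f (kmap d S T @: (g @: fullv)).
move=> fE; apply: (@leq_trans (\dim (kmap d S T @: (g @: fullv)))).
  by rewrite -fE leq_addl.
by apply/dimvS/limgS/subvf.
Qed.

Lemma rk_reindex (I J I' J' : finType) (d : I -> J -> k) (d' : I' -> J' -> k)
    (S : {set I}) (T : {set J}) (S' : {set I'}) (T' : {set J'})
    (e : I' -> I) (e2 : J' -> J) :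
    {in S' &, injective e} -> e @: S' = S ->
    {in T' &, injective e2} -> e2 @: T' = T ->
    {in S' & T', forall i j, d (e i) (e2 j) = d' i j} ->
  rk d S T = rk d' S' T'.
Proof.
move=> eI <- e2I <- dd'.
have sum_delta (I0 I1 : finType) (h : I0 -> I1) (U : {set I0}) (F : I0 -> k) (x : I0) :
    {in U &, injective h} -> x \in U ->
    \sum_(y in U) (h y == h x)%:R * F y = F x.
  move=> hI xU; rewrite (bigD1 x) //= eqxx mul1r big1 ?addr0 // => y /andP[yU yx].
  by case: eqP => [/(hI _ _ yU xU)/eqP|]; rewrite ?(negPf yx) // mul0r.
apply/eqP; rewrite eqn_leq; apply/andP; split.
- apply: (@rk_factor _ _ _ _ _ _ _ _ _ _ (kmap (fun i i' => (e i' == i)%:R) (e @: S') S')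
    (kmap (fun j' j => (e2 j' == j)%:R) T' (e2 @: T'))).
  apply/lfunP => f; apply/ffunP => i; rewrite !comp_lfunE !kmapE.
  case: ifP => // /imsetP[i' i'S ->]; symmetry.
  rewrite sum_delta //.
  rewrite kmapE i'S big_imset //=; apply: eq_bigr => j jT.
  rewrite dd' //; congr (_ * _); rewrite kmapE jT.
  rewrite big_imset //=; under eq_bigr do rewrite eq_sym.
  exact: (sum_delta _ _ _ _ (fun j => f (e2 j))).
- apply: (@rk_factor _ _ _ _ _ _ _ _ _ _ (kmap (fun i' i => (e i' == i)%:R) S' (e @: S'))
    (kmap (fun j j' => (e2 j' == j)%:R) (e2 @: T') T')).
  apply/lfunP => f; apply/ffunP => i; rewrite !comp_lfunE !kmapE.
  case: ifP => // iS; rewrite big_imset //=; symmetry.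
  under eq_bigr do rewrite eq_sym.
  rewrite (sum_delta _ _ _ _ (fun j => kmap d _ _ _ (e j))) //.
  rewrite kmapE imset_f // big_imset //=; apply: eq_bigr => j jT.
  by rewrite dd' // kmapE imset_f // sum_delta.
Qed.

Definition supported (I : finType) (S : {set I}) : {vspace {ffun I -> k^o}} :=
  limg (restriction S).

Lemma supportedP (I : finType) (S : {set I}) (f : {ffun I -> k^o}) :
  reflect (forall i, i \notin S -> f i = 0) (f \in supported S).
Proof.
apply: (iffP memv_imgP) => [[g _ ->] i iS|f0].
  by rewrite restrictionE (negPf iS).
exists f; rewrite ?memvf //; apply/ffunP => i; rewrite restrictionE.
by case: ifP => // /negbT/f0.
Qed.

Lemma limg_kmap_supported (I J : finType) (d : I -> J -> k) (S : {set I}) (T : {set J}) :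
  (kmap d S T @: supported T = limg (kmap d S T))%VS.
Proof.
apply/eqP; rewrite eqEsubv limgS ?subvf //=; apply/subvP => _ /memv_imgP[f _ ->].
rewrite (@eq_kmap_arg _ _ _ _ _ _ (restriction T f)) => [|j jT].
  by apply/memv_img/memv_img/memvf.
by rewrite restrictionE jT.
Qed.

Lemma dim_supported (I : finType) (S : {set I}) : \dim (supported S) = #|S|.
Proof.
rewrite -/(rk _ S S).
rewrite (@rk_reindex _ _ _ _ _ (fun i j : 'I_#|S| => (i == j)%:R) _ _ setT setT enum_val enum_val).
- rewrite /rk -/(supported [set: 'I_#|S|]).
  have -> : supported [set: 'I_#|S|] = fullv.
    apply/vspaceP => f; rewrite memvf; apply/supportedP => i.
    by rewrite inE.
  by rewrite dimvf /dim /= card_ord muln1.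
- by move=> ? ? _ _ /enum_val_inj.
- apply/setP => i; apply/imsetP/idP => [[j _ ->]|iS]; first exact: enum_valP.
  by exists (enum_rank_in iS i); rewrite ?enum_rankK_in.
- by move=> ? ? _ _ /enum_val_inj.
- apply/setP => i; apply/imsetP/idP => [[j _ ->]|iS]; first exact: enum_valP.
  by exists (enum_rank_in iS i); rewrite ?enum_rankK_in.
- by move=> i j _ _; rewrite (inj_eq enum_val_inj).
Qed.

(** The two families of columns have their nonzero entries in complementary
    sets of rows, so their images are independent. *)
Lemma rk_split (I J : finType) (d : I -> J -> k) (S : {set I}) (T T' : {set J}) (P : {set I}) :
    {in S & T, forall i j, i \notin P -> d i j = 0} ->
    {in S & T', forall i j, i \in P -> d i j = 0} ->
    [disjoint T & T'] ->
  rk d S (T :|: T') = (rk d S T + rk d S T')%N.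
Proof.
move=> dT dT' TT'; rewrite /rk.
have sT : (limg (kmap d S T) <= supported P)%VS.
  apply/subvP => _ /memv_imgP[f _ ->]; apply/supportedP => i iP; rewrite kmapE.
  case: ifP => // iS; rewrite big1 // => j jT.
  by rewrite dT // mul0r.
have sT' : (limg (kmap d S T') <= supported (~: P))%VS.
  apply/subvP => _ /memv_imgP[f _ ->]; apply/supportedP => i; rewrite inE negbK kmapE => iP.
  case: ifP => // iS; rewrite big1 // => j jT.
  by rewrite dT' // mul0r.
rewrite -dimv_disjoint_sum; last first.
  apply/eqP; rewrite -subv0; apply/subvP => f /memv_capP[/(subvP sT) fT /(subvP sT') fT'].
  rewrite memv0; apply/eqP/ffunP => i; rewrite [RHS]ffunE.
  have [iP|iP] := boolP (i \in P); last by move/supportedP: fT => ->.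
  by move/supportedP: fT' => ->; rewrite // inE iP.
congr (\dim _); apply/eqP; rewrite eqEsubv; apply/andP; split.
  apply/subvP => _ /memv_imgP[f _ ->].
  have -> : kmap d S (T :|: T') f = kmap d S T f + kmap d S T' f.
    apply/ffunP => i; rewrite ffunE !kmapE; case: ifP => _; last by rewrite addr0.
    by rewrite sum_setU.
  by apply: memv_add; rewrite memv_img ?memvf.
rewrite subv_add; apply/andP; split; apply/subvP => _ /memv_imgP[f _ ->].
- have -> : kmap d S T f = kmap d S (T :|: T') (restriction T f).
    apply/ffunP => i; rewrite !kmapE; case: ifP => // _.
    rewrite (sum_setU _ TT') /= [X in _ + X]big1 ?addr0; last first.
      by move=> j jT'; rewrite restrictionE (disjointFl TT' jT') mulr0.
    by apply: eq_bigr => j jT; rewrite restrictionE jT.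
  by rewrite memv_img ?memvf.
- have -> : kmap d S T' f = kmap d S (T :|: T') (restriction T' f).
    apply/ffunP => i; rewrite !kmapE; case: ifP => // _.
    rewrite (sum_setU _ TT') /= [X in X + _]big1 ?add0r; last first.
      by move=> j jT; rewrite restrictionE (disjointFr TT' jT) mulr0.
    by apply: eq_bigr => j jT'; rewrite restrictionE jT'.
  by rewrite memv_img ?memvf.
Qed.

(** The rank of a block-diagonal matrix.  It serves twice: with p and q the
    degrees, to recover the total coboundary from its homogeneous parts, and
    with p = q, to decompose a complex into a direct sum. *)
Lemma rk_classes (I J : finType) (d : I -> J -> k) (S : {set I}) (T : {set J})
    (Q : eqType) (p : I -> Q) (q : J -> Q) (s : seq Q) :
    uniq s -> {in T, forall j, q j \in s} ->
    {in S & T, forall i j, p i != q j -> d i j = 0} ->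
  rk d S T =
  (\sum_(c <- s) rk d [set i in S | p i == c] [set j in T | q j == c])%N.
Proof.
elim: s T => [|c s IHs] T /=.
  move=> _ T0 _; rewrite big_nil.
  apply/eqP; rewrite /rk dimv_eq0 -subv0; apply/subvP => _ /memv_imgP[f _ ->].
  rewrite memv0; apply/eqP/ffunP => i; rewrite kmapE [RHS]ffunE.
  by case: ifP => // _; rewrite big1 // => j /T0.
move=> /andP[cs us] Ts dT; rewrite big_cons.
have -> : T = [set j in T | q j == c] :|: [set j in T | q j != c].
  by apply/setP => j; rewrite !inE; case: (j \in T) (q j == c) => [] [].
rewrite (rk_split (P := [set i | p i == c])); first 1 last.
- by move=> i j iS; rewrite !inE => /andP[jT /eqP qj] pi; apply: dT => //; rewrite qj.
- move=> i j iS; rewrite !inE => /andP[jT qj] /eqP pi; apply: dT => //.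
  by rewrite pi eq_sym.
- rewrite -setI_eq0; apply/eqP/setP => j; rewrite !inE.
  by case: (q j == c); rewrite ?andbF.
congr (_ + _)%N.
  congr (\dim (limg _)); apply: eq_kmap => i j; rewrite !inE.
  case: (boolP (i \in S)) => //= iS; case: (boolP (j \in T)) => //= jT; rewrite ?andbF //.
  have [qj|qj] /= := eqVneq (q j) c; rewrite ?andbF //= andbT.
  by case: (eqVneq (p i) c) => //= pi; rewrite dT // qj.
rewrite (IHs [set j in T | q j != c]) //; first 1 last.
- by move=> j; rewrite inE => /andP[/Ts]; rewrite inE; case: eqP.
- by move=> i j iS; rewrite inE => /andP[jT _]; exact: dT.
apply: eq_big_seq => c' c's; congr rk; apply/setP => j; rewrite !inE.
have [->|] := eqVneq (q j) c'; rewrite ?andbF // !andbT.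
have -> /= : (c' == c) = false by apply/eqP => cc; rewrite -cc c's in cs.
by rewrite andbT andbF.
Qed.

(** The submatrix with columns b in B and rows phi b is triangular with nonzero
    diagonal once B is ordered by w.  For chain complexes this is the
    acyclicity of a discrete Morse matching of b with phi b. *)
Lemma rk_matching (I J : finType) (d : I -> J -> k) (S : {set I}) (T B : {set J})
    (phi : J -> I) (w : J -> nat) :
    B \subset T -> {in B, forall b, phi b \in S} ->
    {in B, forall b, d (phi b) b != 0} ->
    {in B &, forall b b', b != b' -> d (phi b') b != 0 -> (w b' < w b)%N} ->
  (#|B| <= rk d S T)%N.
Proof.
move=> BT phiS dphi dlt; rewrite -dim_supported.
rewrite -(@limg_dim_eq _ _ _ (kmap d S T)); first by apply/dimvS/limgS/subvf.
apply/eqP; rewrite -subv0; apply/subvP => f /memv_capP[/supportedP fB].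
rewrite memv_ker => /eqP df; rewrite memv0; apply/eqP/ffunP => j; rewrite [RHS]ffunE.
have [jB|/fB//] := boolP (j \in B).
pose N := \max_(b in B) w b.
have wN b : b \in B -> (w b <= N)%N by move=> bB; rewrite /N (bigD1 b) //= leq_maxl.
have [n] := ubnP (N - w j)%N; elim: n j jB => // n IHn b' bB' /ltnSE wn.
have /ffunP/(_ (phi b')) := df; rewrite kmapE [RHS]ffunE phiS //.
rewrite (bigD1 b') ?(subsetP BT) //= big1 ?addr0; last first.
  move=> b /andP[bT bb']; have [bB|/fB->] := boolP (b \in B); last by rewrite mulr0.
  have [->|db] := eqVneq (d (phi b') b) 0; first by rewrite mul0r.
  rewrite IHn ?mulr0 //; apply: leq_trans wn.
  by have := dlt _ _ bB bB' bb' db; have := wN _ bB; lia.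
by move/eqP; rewrite mulf_eq0 (negPf (dphi _ _)) //= => /eqP.
Qed.

Section SquareZero.
Variables (I : finType) (d : I -> I -> k).

Lemma kmap_supported (S T : {set I}) : (limg (kmap d S T) <= supported S)%VS.
Proof.
apply/subvP => _ /memv_imgP[f _ ->]; apply/supportedP => i iS.
by rewrite kmapE (negPf iS).
Qed.

(** The image of a square-zero map lies in its kernel, so that rank and nullity
    add up to at least twice the rank. *)
Lemma rk_square_zero (S : {set I}) :
  (forall f, kmap d S S (kmap d S S f) = 0) -> (2 * rk d S S <= #|S|)%N.
Proof.
move=> dd; rewrite -(dim_supported S) -(limg_ker_dim (kmap d S S)) mul2n -addnn.
rewrite limg_kmap_supported leq_add2r dimvS // subv_cap kmap_supported /=.
by apply/subvP => _ /memv_imgP[f _ ->]; rewrite memv_ker dd.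
Qed.

(** S1 spans a subcomplex, with quotient complex S2, and the bound on #|S2|
    forces this quotient to be exact.  The statement is the isomorphism of the
    homology of the complex with that of the subcomplex, read off from the long
    exact sequence and expressed by ranks. *)
Lemma rk_extension (S1 S2 : {set I}) (S := S1 :|: S2) :
    [disjoint S1 & S2] -> {in S2 & S1, forall i j, d i j = 0} ->
    (forall f, kmap d S S (kmap d S S f) = 0) ->
    (#|S2| <= 2 * rk d S2 S2)%N ->
  rk d S S = (rk d S1 S1 + rk d S2 S2)%N.
Proof.
move=> S12 d0 dd acyc.
have D2E f : restriction S2 (kmap d S S f) = kmap d S2 S2 f.
  apply/ffunP => i; rewrite restrictionE !kmapE inE; case: ifP => // iS2.
  rewrite iS2 orbT (sum_setU _ S12) /= big1 ?add0r // => j jS1.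
  by rewrite d0 // mul0r.
have D2r f : kmap d S2 S2 (restriction S2 f) = kmap d S2 S2 f.
  by apply: eq_kmap_arg => i iS; rewrite restrictionE iS.
have D2D2 f : kmap d S2 S2 (kmap d S2 S2 f) = 0.
  by rewrite -[kmap d S2 S2 f]D2E D2r -D2E dd linear0.
(* Exactness of the quotient complex, by counting dimensions. *)
have ker2 : (supported S2 :&: lker (kmap d S2 S2) = limg (kmap d S2 S2))%VS.
  apply/eqP; rewrite eq_sym eqEdim subv_cap kmap_supported /=; apply/andP; split.
    by apply/subvP => _ /memv_imgP[f _ ->]; rewrite memv_ker D2D2.
  rewrite -(leq_add2r (\dim (kmap d S2 S2 @: supported S2))).
  by rewrite limg_ker_dim dim_supported limg_kmap_supported addnn -mul2n.
have D1E f : restriction S2 f = 0 -> kmap d S S f = kmap d S1 S1 f.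
  move=> /ffunP f0; have {}f0 i : i \in S2 -> f i = 0.
    by move=> iS; have := f0 i; rewrite restrictionE iS ffunE.
  apply/ffunP => i; rewrite !kmapE inE; case: (boolP (i \in S1)) => iS1 /=.
    rewrite (sum_setU _ S12) /= [X in _ + X]big1 ?addr0 // => j jS2.
    by rewrite f0 // mulr0.
  case: ifP => // iS2; rewrite big1 // => j; rewrite inE => /orP[jS1|jS2].
    by rewrite d0 // mul0r.
  by rewrite f0 // mulr0.
(* The image of the whole map is split by the projection to the quotient: its
   projection is the image of the quotient map, and its part in the subcomplex
   is already reached from the subcomplex. *)
rewrite {1}/rk -(limg_ker_dim (restriction S2) (limg (kmap d S S))); congr (_ + _)%N.
  congr (\dim _); apply/eqP; rewrite eqEsubv; apply/andP; split.
    apply/subvP => v /memv_capP[/memv_imgP[w _ ->]].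
    rewrite memv_ker D2E => /eqP D2w.
    (* w is a cocycle modulo S1, hence a coboundary modulo S1; subtracting this
       coboundary moves w into the subcomplex without changing its image. *)
    have : restriction S2 w \in limg (kmap d S2 S2).
      rewrite -ker2 memv_cap memv_img ?memvf // memv_ker.
      by rewrite D2r D2w eqxx.
    case/memv_imgP => u _ wE.
    have -> : kmap d S S w = kmap d S S (w - kmap d S S u).
      by rewrite linearB /= dd subr0.
    rewrite D1E ?memv_img ?memvf //.
    by rewrite linearB /= wE D2E subrr.
  apply/subvP => _ /memv_imgP[f _ ->].
  have r0 : restriction S2 (restriction S1 f) = 0.
    apply/ffunP => i; rewrite !restrictionE [RHS]ffunE; case: ifP => // iS2.
    by rewrite (disjointFl S12 iS2).
  have -> : kmap d S1 S1 f = kmap d S1 S1 (restriction S1 f).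
    by apply: eq_kmap_arg => i iS; rewrite restrictionE iS.
  rewrite -D1E // memv_cap memv_img ?memvf //= memv_ker D2E -D2r r0 linear0.
  by [].
rewrite -limg_comp; congr (\dim (limg _)); apply/lfunP => f.
by rewrite comp_lfunE D2E.
Qed.

End SquareZero.
End KernelRank.

(** * Chains in a finite poset and complements of an element *)

Section Chains.
Variables (k : fieldType) (disp : Order.disp_t) (T : finPOrderType disp).
Implicit Types (C Q : {set T}) (x y : T).

Definition chains_in Q : {set {set T}} :=
  [set C : {set T} | (C \subset Q) && [forall x in C, forall y in C, (x >=< y)%O]].

Lemma chains_inP Q C :
  reflect ({in C, forall x, x \in Q} /\ {in C &, forall x y, (x >=< y)%O})
          (C \in chains_in Q).
Proof.
rewrite inE; apply: (iffP andP) => [[/subsetP CQ /forall_inP cC]|[CQ cC]].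
  by split=> // x y xC yC; exact: (forall_inP (cC x xC)).
split; first exact/subsetP.
by apply/forall_inP => x xC; apply/forall_inP => y yC; exact: cC.
Qed.

Lemma chains_in_sub Q C C' : C' \subset C -> C \in chains_in Q -> C' \in chains_in Q.
Proof.
move=> /subsetP CC /chains_inP[CQ cC]; apply/chains_inP.
by split=> [x /CC/CQ|x y /CC xC /CC yC] //; exact: cC.
Qed.

Lemma chain_has_max C : {in C &, forall x y, (x >=< y)%O} -> C != set0 ->
  exists2 x, x \in C & {in C, forall y, (y <= x)%O}.
Proof.
move=> cC /set0Pn[x0 x0C].
case: (@arg_maxnP _ x0 (mem C) (fun x => #|[set y in C | (y <= x)%O]|) x0C).
move=> x xC xmax; exists x => // y yC.
case: (comparable_leP (cC _ _ yC xC)) => // xy.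
suff /ltn_geF : (#|[set y in C | (y <= x)%O]| < #|[set z in C | (z <= y)%O]|)%N.
  by have /= -> := xmax y yC.
apply/proper_card/properP; split.
  by apply/subsetP => z; rewrite !inE => /andP[-> zx]; exact: le_trans (ltW xy).
by exists y; rewrite !inE yC ?lexx // lt_geF.
Qed.

Definition below_sign C x : k := (-1) ^+ #|[set y in C | (y < x)%O]|.

(** The coboundary of order cohomology, with chains seen as sets: an element
    inserted at position j has exactly j smaller elements in the new chain, and
    this description of the sign needs no enumeration of the chain. *)
Definition incidence C' C : k :=
  \sum_(x in C') (C' :\ x == C)%:R * below_sign C' x.

Lemma incidence_neq0 C' C :
  incidence C' C != 0 -> exists2 x, x \in C' & C = C' :\ x.
Proof.
have [/exists_inP[x xC /eqP CE]|/exists_inPn CC] := boolP [exists x in C', C' :\ x == C].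
  by exists x.
by rewrite /incidence big1 ?eqxx // => x /CC /negPf ->; rewrite mul0r.
Qed.

Lemma incidence_setD1 C x : x \in C -> incidence C (C :\ x) = below_sign C x.
Proof.
move=> xC; rewrite /incidence (bigD1 x) //= eqxx mul1r big1 ?addr0 // => y /andP[yC yx].
case: eqP => [/setP/(_ y)|]; last by rewrite mul0r.
by rewrite !inE eqxx yx yC.
Qed.

Lemma kmap_chainsE Q (f : {ffun {set T} -> k^o}) C : C \in chains_in Q ->
  kmap incidence (chains_in Q) (chains_in Q) f C =
  \sum_(x in C) below_sign C x * f (C :\ x).
Proof.
move=> CQ; rewrite kmapE CQ /incidence.
under eq_bigr do rewrite mulr_suml.
rewrite exchange_big /=; apply: eq_bigr => x xC.
rewrite (bigD1 (C :\ x)) /=; last exact: chains_in_sub (subsetDl _ _) CQ.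
rewrite eqxx mul1r big1 ?addr0 // => B /andP[_ /negPf].
by rewrite eq_sym => ->; rewrite !mul0r.
Qed.

(** Removing x first lowers the position of y by one when x < y, while removing
    y first does not move x. *)
Lemma below_sign_swap C x y : x \in C -> y \in C -> (x < y)%O ->
  below_sign C y * below_sign (C :\ y) x = - (below_sign C x * below_sign (C :\ x) y).
Proof.
move=> xC yC xy; rewrite /below_sign.
have -> : [set z in C :\ y | (z < x)%O] = [set z in C | (z < x)%O].
  apply/setP => z; rewrite !inE; case: eqP => //= ->.
  by rewrite [RHS]andbC lt_gtF.
have -> : [set z in C | (z < y)%O] = x |: [set z in C :\ x | (z < y)%O].
  by apply/setP => z; rewrite !inE; case: eqP => //= ->; rewrite xC xy.
by rewrite cardsU1 !inE eqxx /= exprS mulN1r mulNr mulrC.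
Qed.

(** Each chain lacking two elements x < y of C is reached through C minus x and
    through C minus y, with opposite signs. *)
Lemma kmap_chains_square Q (f : {ffun {set T} -> k^o}) :
  kmap incidence (chains_in Q) (chains_in Q)
    (kmap incidence (chains_in Q) (chains_in Q) f) = 0.
Proof.
apply/ffunP => C; rewrite [RHS]ffunE.
have [CQ|/negPf CQ] := boolP (C \in chains_in Q); last by rewrite kmapE CQ.
pose G x y := below_sign C x * below_sign (C :\ x) y * f (C :\ x :\ y).
have [_ cC] := chains_inP _ _ CQ.
have -> : kmap incidence (chains_in Q) (chains_in Q)
    (kmap incidence (chains_in Q) (chains_in Q) f) C
  = \sum_(x in C) (\sum_(y in C | (x < y)%O) G x y + \sum_(y in C | (y < x)%O) G x y).
  rewrite kmap_chainsE //; apply: eq_bigr => x xC.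
  rewrite kmap_chainsE; last exact: chains_in_sub (subsetDl _ _) CQ.
  rewrite mulr_sumr (bigID (fun y => (x < y)%O)) /=; congr (_ + _).
    apply: eq_big => [y|y _]; last by rewrite mulrA.
    by rewrite !inE; case: eqP => [->|] //=; rewrite ltxx andbF.
  apply: eq_big => [y|y _]; last by rewrite mulrA.
  rewrite !inE; case: eqP => [->|/eqP yx] //=; first by rewrite ltxx andbF.
  case: (boolP (y \in C)) => //= yC.
  by move: (cC x y xC yC) yx; case: comparableP.
rewrite big_split /= [X in _ + X](exchange_big_dep (fun y => y \in C)) /=; last first.
  by move=> ? ? _ /andP[].
rewrite -big_split big1 // => x xC.
rewrite /= !big_mkcondr -big_split big1 //= => y yC; rewrite xC /=.
case: ifP => [xy|_]; last by rewrite addr0.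
rewrite /G (_ : C :\ y :\ x = C :\ x :\ y); last by rewrite !setDDl setUC.
by rewrite /= (below_sign_swap xC yC xy) mulNr subrr.
Qed.

Lemma chains_rk_le Q :
  (2 * rk incidence (chains_in Q) (chains_in Q) <= #|chains_in Q|)%N.
Proof. exact/rk_square_zero/kmap_chains_square. Qed.

End Chains.

Section Complementation.
Variables (k : fieldType) (disp : Order.disp_t) (T : finBPOrderType disp).

Definition open_int (X : T) : {set T} := [set x | (\bot < x < X)%O].

(** The dimension of the total cohomology of [\bot, X]: for a square-zero map
    on a space of dimension N, kernel modulo image has dimension N minus twice
    the rank.  The empty chain counts, in accordance with reduced cohomology;
    for X = \bot it stands for the generator in degree -2. *)
Definition chain_betti (X : T) : nat :=
  #|chains_in (open_int X)|
    - 2 * rk (@incidence k _ T) (chains_in (open_int X)) (chains_in (open_int X)).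

Lemma chain_betti_bot : chain_betti \bot%O = 1%N.
Proof.
have KE : chains_in (open_int \bot%O) = [set set0].
  apply/setP => C; rewrite in_set1; apply/idP/eqP => [/chains_inP[CQ _]|->].
    by apply/setP => x; rewrite in_set0; apply/negP => /CQ; rewrite inE ltx0 andbF.
  by apply/chains_inP; split=> [x|x y]; rewrite inE.
have := chains_rk_le k (open_int \bot%O); rewrite /chain_betti KE cards1.
by case: (rk _ _ _) => // n; rewrite mulnS.
Qed.

Variables (a X : T) (j : T -> T).
Hypothesis jP : forall x z, (j x <= z)%O = (x <= z)%O && (a <= z)%O.
Hypothesis a_gt0 : (\bot < a)%O.
Hypothesis aX : (a <= X)%O.

(** With j the join with a, these are the y for which a and y join to X; they
    complement a in [\bot, X] when a is an atom. *)
Definition complements : {set T} :=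
  [set y | (y <= X)%O && ~~ (a <= y)%O && (j y == X)].

Hypothesis co_coatom :
  forall y z, y \in complements -> (y < z)%O -> (z < X)%O = false.

Let le_j x : (x <= j x)%O. Proof. by have := lexx (j x); rewrite {1}jP => /andP[]. Qed.
Let a_le_j x : (a <= j x)%O. Proof. by have := lexx (j x); rewrite {1}jP => /andP[]. Qed.
Let d := @incidence k _ T.

Section Matching.
Hypothesis a_lt_X : (a < X)%O.

Let Q' := open_int X :\: complements.
Let low (C : {set T}) := [set x in C | ~~ (a <= x)%O].
Let high (C : {set T}) := [set x in C | (a <= x)%O].
Let top_of (L : {set T}) := odflt \bot%O [pick x in L | [forall y in L, (y <= x)%O]].
(** In a chain avoiding the complements, the elements not above a come first.
    The join of a with the largest of them is still different from X, and it is
    comparable with every element of the chain, so it can be added to the chain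
    or removed from it. *)
Let pivot (C : {set T}) := j (top_of (low C)).

Let top_ofP C : C \in chains_in Q' ->
  [/\ {in low C, forall x, (x <= top_of (low C))%O}, (top_of (low C) < X)%O,
      j (top_of (low C)) != X
    & {in high C, forall y, (top_of (low C) <= y)%O}].
Proof.
move=> /chains_inP[CQ cC]; rewrite /top_of; case: pickP => [m /andP[]|noM] /=.
  rewrite inE => /andP[mC am] /forall_inP lm.
  have := CQ m mC; rewrite !inE => /andP[+ /andP[_ mX]].
  rewrite am (ltW mX) /= => jm; split=> //.
  move=> y; rewrite inE => /andP[yC ay]; case: (comparable_leP (cC _ _ mC yC)) => // ym.
  by rewrite (le_trans ay (ltW ym)) in am.
have -> : low C = set0.
  apply/eqP; apply: contraT => /chain_has_max[x y|x xL xmax].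
    by rewrite !inE => /andP[xC _] /andP[yC _]; exact: cC.
  by have := noM x; rewrite xL /=; move/negP; case; exact/forall_inP.
split=> [x||| y _]; first by rewrite inE.
- exact: lt_trans a_lt_X.
- apply: contraTneq a_lt_X => <-; apply/negP => /lt_geF.
  by rewrite jP le0x lexx.
- exact: le0x.
Qed.

Let pivot_in C : C \in chains_in Q' -> pivot C |: C \in chains_in Q'.
Proof.
move=> CQ; have [lowm mX jm highm] := top_ofP CQ; have [CQ' cC] := chains_inP _ _ CQ.
have zX : (pivot C < X)%O by rewrite lt_neqAle jm jP (ltW mX) aX.
have zQ : pivot C \in Q' by rewrite !inE a_le_j andbF (lt_le_trans a_gt0 (a_le_j _)) zX.
have zC x : x \in C -> (pivot C >=< x)%O.
  move=> xC; rewrite /Order.comparable; have [ax|ax] := boolP (a <= x)%O.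
    by rewrite jP ax highm // inE xC.
  by rewrite (le_trans _ (le_j _)) ?orbT // lowm // inE xC.
apply/chains_inP; split=> [x|x y]; rewrite !in_setU1.
  by case/predU1P => [->|/CQ'].
case/predU1P => [->|xC]; case/predU1P => [->|yC]; rewrite ?comparablexx //.
- exact: zC.
- by rewrite comparable_sym zC.
- exact: cC.
Qed.

(** The pivot depends only on the elements not above a, while it is itself
    above a; toggling it therefore leaves it unchanged. *)
Let low_pivot C x : (a <= x)%O -> low (x |: C) = low C.
Proof. by move=> ax; apply/setP => y; rewrite !inE; case: eqP => //= ->; rewrite ax andbF. Qed.

Let low_pivotD C x : (a <= x)%O -> low (C :\ x) = low C.
Proof. by move=> ax; apply/setP => y; rewrite !inE; case: eqP => //= ->; rewrite ax andbF. Qed.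

Let pivot_free := [set C in chains_in Q' | pivot C \notin C].

Let card_pivot_free : (#|chains_in Q'| <= 2 * #|pivot_free|)%N.
Proof.
pose U := [set C in chains_in Q' | pivot C \in C].
have -> : chains_in Q' = pivot_free :|: U.
  by apply/setP => C; rewrite !inE -andb_orr orNb andbT.
rewrite mul2n -addnn; apply: leq_trans (leq_card_setU _ _).1 _; rewrite leq_add2l.
have DI : {in U &, injective (fun C => C :\ pivot C)}.
  move=> C C'; rewrite inE [C' \in _]inE => /andP[_ zC] /andP[_ zC'] /= CC.
  have zz : pivot C = pivot C'.
    by rewrite /pivot -(@low_pivotD C (pivot C)) ?a_le_j // CC low_pivotD ?a_le_j.
  by rewrite -(setD1K zC) CC -zz zz setD1K.
rewrite -(card_in_imset DI); apply/subset_leq_card/subsetP => _ /imsetP[C CU ->].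
move: CU; rewrite inE => /andP[CQ zC]; rewrite inE; apply/andP; split.
  exact: chains_in_sub (subsetDl _ _) CQ.
by rewrite /pivot low_pivotD // !inE eqxx.
Qed.

(** Exactness away from the complements.  Every chain is matched with the one
    obtained by toggling its pivot.  If C' with its pivot added covers a second
    pivot-free chain C, then the removed element is not above a: otherwise C
    and C' would have the same pivot, and C would contain it.  So C has one
    more element above a than C', which makes the matching triangular. *)
Lemma rk_no_complements :
  (2 * rk d (chains_in Q') (chains_in Q'))%N = #|chains_in Q'|.
Proof.
apply/eqP; rewrite eqn_leq chains_rk_le; apply: leq_trans card_pivot_free _.
rewrite leq_pmul2l //.
apply: (@rk_matching _ _ _ _ _ _ _ (fun C => pivot C |: C) (fun C => #|high C|)).
- by apply/subsetP => C; rewrite inE => /andP[].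
- by move=> C; rewrite inE => /andP[/pivot_in].
- move=> C; rewrite inE => /andP[_ zC].
  by have := incidence_setD1 k (setU11 (pivot C) C); rewrite setU1K // /d => ->; rewrite signr_eq0.
move=> C C'; rewrite inE [C' \in _]inE => /andP[_ zC] /andP[_ zC'] CC' /incidence_neq0[x].
rewrite in_setU1 => /predU1P[-> CE|xC' CE]; first by rewrite CE setU1K ?eqxx in CC'.
have xz : x != pivot C' by apply: contraNneq zC' => <-.
have ax : ~~ (a <= x)%O.
  apply: contra zC => ax; rewrite /pivot CE low_pivotD // low_pivot ?a_le_j //.
  by rewrite -/(pivot C') !inE eq_sym xz eqxx.
have hE : high C = pivot C' |: high C'.
  apply/setP => y; rewrite CE !inE; case: eqP => [->|_] /=.
    by rewrite (negPf ax) andbF orbF; apply/esym/negbTE.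
  by case: eqP => [->|] //=; rewrite a_le_j.
by rewrite hE cardsU1 !inE (negPf zC').
Qed.

Let K := chains_in (open_int X).
Let K1 := [set C in K | C :&: complements != set0].
Let K2 := chains_in Q'.

Let K_split : K = K1 :|: K2.
Proof.
apply/setP => C; rewrite in_setU [C \in K1]inE.
have [CK|CK] := boolP (C \in K) => /=; last first.
  apply/esym/negbTE; apply: contra CK => /chains_inP[CQ cC].
  by apply/chains_inP; split=> // x /CQ; rewrite inE => /andP[].
have [Cc|//] := eqVneq; apply/esym/chains_inP; have [CQ cC] := chains_inP _ _ CK.
split=> // x xC; rewrite in_setD CQ // andbT; apply/negP => xc.
by move/setP: Cc => /(_ x); rewrite in_setI in_set0 xC xc.
Qed.

Let K12 : [disjoint K1 & K2].
Proof.
rewrite -setI_eq0; apply/eqP/setP => C; rewrite in_setI in_set0 [C \in K1]inE.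
apply/negP => /andP[/andP[_ /set0Pn[x]]]; rewrite in_setI => /andP[xC xc].
by move=> /chains_inP[/(_ x xC)]; rewrite in_setD xc.
Qed.

Let betti_K1 : chain_betti X = (#|K1| - 2 * rk d K1 K1)%N.
Proof.
rewrite /chain_betti -/d -/K K_split rk_extension //.
- rewrite cardsU disjoint_setI0 // cards0 subn0 mulnDr rk_no_complements.
  by rewrite subnDr.
- move=> C C' CK2 C'K1; apply: contraTeq C'K1 => /incidence_neq0[x xC ->].
  by apply/negP => /(disjointFr K12); rewrite (chains_in_sub (subsetDl _ _) CK2).
- by move=> f; rewrite -K_split; exact: kmap_chains_square.
- by rewrite rk_no_complements.
Qed.

Let compl_lt y : y \in complements -> (\bot < y < X)%O.
Proof.
rewrite inE => /andP[/andP[yX ay] /eqP jy]; rewrite !lt_neqAle yX le0x !andbT.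
apply/andP; split.
  apply: contraTneq a_lt_X => y0; apply/negP => /lt_geF.
  by rewrite -jy jP -y0 le0x lexx.
by apply: contraNneq ay => ->.
Qed.

Let K_at y := chains_in (open_int y).
(** The part of the relative complex that involves the complement y. *)
Let fibre y := [set C in K1 | [pick z in C :&: complements] == Some y].

(** A complement y is a coatom of [\bot, X], so in a chain containing it y is
    the largest element and the only complement. *)
Let fibreE y : y \in complements -> fibre y = [set y |: C | C in K_at y].
Proof.
move=> yc; have /andP[y_gt0 y_ltX] := compl_lt yc.
apply/setP => C; apply/idP/imsetP => [|[B /chains_inP[BQ cB] ->]].
  rewrite inE [C \in K1]inE => /andP[/andP[/chains_inP[CQ cC] _]].
  case: pickP => // z; rewrite in_setI => /andP[zC zc] /eqP[zy].
  rewrite {z}zy in zC zc; exists (C :\ y); last by rewrite setD1K.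
  apply/chains_inP; split=> [x|x x']; last first.
    by rewrite !in_setD1 => /andP[_ xC] /andP[_ x'C]; exact: cC.
  rewrite in_setD1 => /andP[xy xC]; have := CQ _ xC; rewrite !inE => /andP[-> xX] /=.
  move: (cC x y xC zC) xy; case: comparableP => // yx _ _.
  by rewrite (co_coatom yc yx) in xX.
have BX x : x \in B -> (\bot < x < y)%O by move=> /BQ; rewrite inE.
have yB : y \in y |: B by exact: setU11.
rewrite inE [_ \in K1]inE -andbA; apply/and3P; split.
- apply/chains_inP; split=> [x|x x']; rewrite !in_setU1.
    case/predU1P => [->|/BX /andP[x0 xy]]; rewrite !inE ?y_gt0 // x0.
    exact: lt_trans xy y_ltX.
  case/predU1P => [->|xB]; case/predU1P => [->|x'B]; rewrite ?comparablexx //.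
  + by have /andP[_ /ltW x'y] := BX _ x'B; rewrite comparable_sym /Order.comparable x'y.
  + by have /andP[_ /ltW xy] := BX _ xB; rewrite /Order.comparable xy.
  + exact: cB.
- by apply/set0Pn; exists y; rewrite in_setI yB.
case: pickP => [z|/(_ y)]; last by rewrite in_setI yB yc.
rewrite in_setI in_setU1 => /andP[/predU1P[->//|/BX /andP[_ zy]] zc].
by have := co_coatom zc zy; rewrite y_ltX.
Qed.

Let y_notin y B : B \in K_at y -> y \notin B.
Proof. by move=> /chains_inP[BQ _]; apply/negP => /BQ; rewrite inE ltxx andbF. Qed.

Let addI y : {in K_at y &, injective (fun B => y |: B)}.
Proof.
by move=> B B' BK B'K /(congr1 (fun C => C :\ y)); rewrite !setU1K ?y_notin.
Qed.

(** Adding y at the top leaves the number of smaller elements, hence every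
    sign, unchanged. *)
Let rk_fibre y : y \in complements -> rk d (fibre y) (fibre y) = rk d (K_at y) (K_at y).
Proof.
move=> yc; apply: (@rk_reindex _ _ _ _ _ _ _ _ _ _ _ (fun B => y |: B) (fun B => y |: B)).
- exact: addI.
- by rewrite fibreE.
- exact: addI.
- by rewrite fibreE.
move=> B' B B'K BK; have yB' := y_notin B'K; have yB := y_notin BK.
rewrite /d /incidence big_setU1 //= [X in X * _](_ : _ = 0) ?mul0r ?add0r.
  apply: eq_bigr => x xB'; have xy : x != y by apply: contraNneq yB' => <-.
  congr (_ * _).
    rewrite setDUl (setDidPl _) ?disjoints1 ?in_set1 1?eq_sym //.
    congr (_ %:R : k); congr nat_of_bool; apply/eqP/eqP => [|-> //].
    by move=> /(congr1 (fun C => C :\ y)); rewrite !setU1K // in_setD1 negb_and yB' orbT.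
  congr (_ ^+ #|pred_of_set _|); apply/setP => z; rewrite !inE.
  case: eqP => //= ->; rewrite (negPf yB') /=.
  have [BQ _] := chains_inP _ _ B'K; have := BQ x xB'; rewrite inE => /andP[_ ?].
  exact: lt_gtF.
rewrite setU1K //; case: eqP => // BE; move: yB'.
by rewrite BE setU11.
Qed.

Lemma chain_betti_lt : chain_betti X = (\sum_(y in complements) chain_betti y)%N.
Proof.
pose s := map Some (enum complements).
pose p (C : {set T}) := [pick z in C :&: complements].
have ps C : C \in K1 -> p C \in s.
  rewrite inE /p => /andP[_ /set0Pn[x xC]]; case: pickP => [z|/(_ x)].
    by rewrite in_setI => /andP[_ zc]; apply: map_f; rewrite mem_enum.
  by rewrite xC.
have pSome C : C \in K1 -> exists2 y, y \in complements & p C = Some y.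
  by move=> /ps; rewrite /s => /mapP[y]; rewrite mem_enum; exists y.
have us : uniq s by rewrite map_inj_uniq ?enum_uniq // => ? ? [].
have sumE (F : option T -> nat) : (\sum_(c <- s) F c = \sum_(y in complements) F (Some y))%N.
  by rewrite big_map big_enum.
rewrite betti_K1 (@rk_classes _ _ _ _ _ _ _ p p s) //; last first.
  move=> C C' CK1 C'K1; apply: contraNeq => /incidence_neq0[x xC C'E].
  have [y yc py] := pSome _ C'K1; rewrite py.
  have: C' \in fibre y by rewrite inE C'K1 -/(p C') py eqxx.
  have [y' y'c py'] := pSome _ CK1; rewrite py'.
  have: C \in fibre y' by rewrite inE CK1 -/(p C) py' eqxx.
  rewrite !fibreE // => /imsetP[B /chains_inP[BQ _] CE] /imsetP[B' _ C'E'].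
  have : y \in C by move: (setU11 y B'); rewrite -C'E' C'E inE => /andP[].
  rewrite CE in_setU1 => /predU1P[->//|/BQ]; rewrite inE => /andP[_ yy'].
  have := co_coatom yc yy'.
  by have /andP[_ ->] := compl_lt y'c.
rewrite sumE big_distrr /=.
have -> : #|K1| = (\sum_(y in complements) #|fibre y|)%N.
  rewrite -(sumE (fun c => #|[set C in K1 | p C == c]|)) -sum1_card.
  rewrite (partition_big p (mem s)) //= -big_uniq //; apply: eq_bigr => c _.
  by rewrite -sum1_card; apply: eq_bigl => C; rewrite inE.
rewrite -sumnB => [|y yc]; last first.
  by rewrite -/(fibre y) rk_fibre // fibreE // card_in_imset ?chains_rk_le //; exact: addI.
apply: eq_bigr => y yc; rewrite -/(fibre y) rk_fibre // fibreE //.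
by rewrite card_in_imset //; exact: addI.
Qed.

End Matching.

(** The case a = X is separate because the contraction then has no centre in
    the open interval; there the coatom hypothesis makes X an atom. *)
Theorem chain_betti_complements :
  chain_betti X = (\sum_(y in complements) chain_betti y)%N.
Proof.
have [a_eqX|a_neqX] := eqVneq a X; last by apply: chain_betti_lt; rewrite lt_neqAle a_neqX.
have bc : \bot%O \in complements.
  rewrite inE le0x (lt_geF a_gt0) -a_eqX /=; apply/eqP/le_anti.
  by rewrite jP le0x lexx a_le_j.
rewrite (big_pred1 \bot%O) => [|y] /=; last first.
  apply/idP/eqP => [yc|-> //]; apply/eqP; apply: contraT => y0.
  have y_gt0 : (\bot < y)%O by rewrite lt_neqAle eq_sym y0 le0x.
  move: yc; rewrite inE => /andP[/andP[yX ay] _].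
  have := co_coatom bc y_gt0; rewrite lt_neqAle yX andbT => /negbFE/eqP yE.
  by rewrite yE aX in ay.
rewrite /chain_betti (_ : open_int X = open_int \bot%O) //.
apply/setP => x; rewrite !inE ltx0 andbF; apply/negbTE/negP => /andP[x0 xX].
by rewrite (co_coatom bc x0) in xX.
Qed.

End Complementation.

(** * Order cohomology in terms of chains *)

Section ChainsAsSets.
Variables (k : fieldType) (disp : Order.disp_t) (P : finTBPOrderType disp).

Definition strict_chain (s : seq P) :=
  sorted (fun x y => (x < y)%O) s && all (fun x => (x != \bot%O) && (x != \top%O)) s.

Lemma strict_chain_cat (a b : seq P) y : strict_chain (a ++ y :: b) ->
  [/\ {in a, forall x, (x < y)%O}, {in b, forall x, (y < x)%O},
      (\bot < y < \top)%O & strict_chain (a ++ b)].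
Proof.
rewrite /strict_chain !(sorted_pairwise lt_trans) !pairwise_cat /= !all_cat /= allrel_consr.
case/andP => /and4P[/andP[ay ab] pa yb pb] /and3P[aa /andP[y0 y1] bb].
split.
- by move=> x xa; exact: (allP ay).
- by move=> x xb; exact: (allP yb).
- by rewrite lt0x y0 ltx1.
- by rewrite ab pa pb aa bb.
Qed.

Lemma strict_chain_uniq s : strict_chain s -> uniq s.
Proof. by case/andP => ss _; exact: (lt_sorted_uniq ss). Qed.

Lemma strict_chain_inj s t : strict_chain s -> strict_chain t ->
  [set x in s] = [set x in t] -> s = t.
Proof.
move=> /andP[ss _] /andP[st _] /setP s_t; apply: lt_sorted_eq => // x.
by have := s_t x; rewrite !inE.
Qed.

Lemma strict_chain_in s :
  strict_chain s -> [set x in s] \in chains_in (open_int (\top%O : P)).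
Proof.
case/andP => ss /allP bs; apply/chains_inP; split=> [x|x y]; rewrite !inE.
  by move=> /bs; rewrite lt0x ltx1.
move: ss; rewrite (sorted_pairwise lt_trans) => /(pairwiseP x) ps.
move=> xs ys; case: (ltngtP (index x s) (index y s)) => xy.
- have := ps (index x s) (index y s); rewrite !inE !index_mem => /(_ xs ys xy).
  by rewrite !nth_index // => /ltW; exact: le_comparable.
- have := ps (index y s) (index x s); rewrite !inE !index_mem => /(_ ys xs xy).
  by rewrite !nth_index // => /ltW; exact: ge_comparable.
- by rewrite -(nth_index x xs) xy nth_index // comparablexx.
Qed.

Lemma strict_chain_ex C : C \in chains_in (open_int (\top%O : P)) ->
  exists2 s, strict_chain s & C = [set x in s].
Proof.
move=> /chains_inP[CQ cC]; exists (sort <=%O (enum C)); last first.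
  by apply/setP => x; rewrite inE mem_sort mem_enum.
apply/andP; split.
  rewrite lt_sorted_uniq_le sort_uniq enum_uniq /=.
  apply: (sort_sorted_in (P := mem C)); last by apply/allP => x; rewrite mem_enum.
  by move=> x y xC yC; have := cC x y xC yC; rewrite /Order.comparable.
apply/allP => x; rewrite mem_sort mem_enum => /CQ.
by rewrite inE lt0x ltx1.
Qed.

(** For fixed y the inner sums have at most one nonzero term: if y can be
    inserted in s so as to give s', the position is the number of elements of
    s' below y. *)
Lemma insertion_incidence s s' : strict_chain s' -> strict_chain s ->
  \sum_(j < (size s).+1) (-1) ^+ j *
    (\sum_(y : P | (nth \top (\bot :: s) j < y < nth \top s j)%O)
       (s' == take j s ++ y :: drop j s)%:R)
  = incidence k [set x in s'] [set x in s].
Proof.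
move=> cs' cs.
under eq_bigr do rewrite mulr_sumr.
rewrite (exchange_big_dep xpredT) //= /incidence [RHS]big_mkcond /=.
apply: eq_bigr => y _; rewrite inE.
have [ys'|ys'] := boolP (y \in s'); last first.
  rewrite big1 // => j _; case: eqP => [s'E|]; last by rewrite mulr0.
  by rewrite s'E mem_cat inE eqxx orbT in ys'.
have us' := strict_chain_uniq cs'.
case/splitPr: ys' cs' us' => a b cs' us'.
have [ay by_ /andP[y0 y1] cab] := strict_chain_cat cs'.
have ya : y \notin a by apply/negP => /ay; rewrite ltxx.
have yb : y \notin b by apply/negP => /by_; rewrite ltxx.
have -> : [set x in a ++ y :: b] :\ y = [set x in a ++ b].
  apply/setP => x; rewrite !inE !mem_cat inE; case: eqP => [->|] //=.
  by rewrite (negPf ya) (negPf yb).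
have -> : below_sign k [set x in a ++ y :: b] y = (-1) ^+ size a.
  congr (_ ^+ _); rewrite (_ : [set _ in _ | _] = [set x in a]).
    rewrite cardsE; apply/card_uniqP.
    by move: us'; rewrite cat_uniq => /and3P[].
  apply/setP => x; rewrite !inE mem_cat inE.
  have [/ay ->//|xa] := boolP (x \in a).
  case: eqP => [->|_] /=; first by rewrite ltxx.
  by apply/negP => /andP[/by_ /lt_gtF ->].
case: eqP => [/(strict_chain_inj cab cs) sE|sE].
  rewrite mul1r -sE; have jlt : (size a < (size (a ++ b)).+1)%N.
    by rewrite size_cat ltnS leq_addr.
  rewrite (bigD1 (Ordinal jlt)) /=; last first.
    rewrite nth_cat ltnn subnn; apply/andP; split; last first.
      by case: (b) by_ => [|z b'] //= zb; rewrite zb ?inE ?eqxx.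
    case/lastP: (a) ay => [|a' z] //= za.
    by rewrite size_rcons /= cat_rcons nth_cat ltnn subnn /= za // mem_rcons inE eqxx.
  rewrite take_size_cat // drop_size_cat // eqxx mulr1 big1 ?addr0 // => j /andP[_ jj].
  case: eqP => [|_]; last by rewrite mulr0.
  move=> abE; case/eqP: jj; apply/val_inj => /=.
  have js : (j <= size (a ++ b))%N by rewrite -ltnS.
  have := congr1 (nth y ^~ j) abE => /=.
  rewrite [RHS]nth_cat size_takel // ltnn subnn /= => yj.
  have /eqP : index y (a ++ y :: b) = j :> nat.
    by rewrite -{1}yj index_uniq // (leq_ltn_trans js) // !size_cat /= addnS.
  by rewrite index_cat (negPf ya) /= eqxx addn0 => /eqP.
rewrite mul0r big1 // => j _; case: eqP => [abE|]; last by rewrite mulr0.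
case: sE; apply/setP => x; rewrite !inE.
have xs : (x \in s) = (x \in take j s ++ drop j s) by rewrite cat_take_drop.
have ys : y \notin take j s ++ drop j s.
  have : uniq (y :: (take j s ++ drop j s)).
    by rewrite -(perm_uniq (permEl (perm_catCA _ [:: y] _))) /= -abE.
  by case/andP.
have := congr1 (fun t : seq P => x \in t) abE; rewrite xs !mem_cat !inE.
have [->|] := eqVneq x y; last by [].
by move: ys; rewrite mem_cat => /negPf ->; rewrite (negPf ya) (negPf yb).
Qed.

End ChainsAsSets.

Section TotalCohomology.
Variables (k : fieldType) (disp : Order.disp_t) (P : finTBPOrderType disp).

Let K : {set {set P}} := chains_in (open_int (\top%O : P)).
Let d := @incidence k _ P.
Let graded (i : int) : {set {set P}} := [set C in K | #|C|%:Z == i + 1].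

Definition coboundary_matrix (i i' : int) (c' : chain P i') (c : chain P i) : k :=
  coboundary_chain k i' (val c : seq P) c'.

Lemma coboundary_kmap i i' :
  coboundary k P i i' = kmap (@coboundary_matrix i i') setT setT.
Proof.
apply/lfunP => f; apply/ffunP => c'; rewrite kmapE inE lfunE /= /coboundary_fun.
rewrite sum_ffunE /=; apply: eq_big => [c|c _]; first by rewrite inE.
by rewrite ffunE /= /coboundary_matrix mulrC.
Qed.

(** Kernel modulo image has dimension N - r - r', where r and r' are the ranks
    of the outgoing and the incoming coboundary; the first conclusion keeps the
    truncated subtraction honest. *)
Lemma has_dim_order_cohomology (i : int) :
    (forall f, coboundary k P i (i + 1) (coboundary k P (i - 1) i f) = 0) ->
    let r j j' := rk (@coboundary_matrix j j') setT setT in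
    (r i (i + 1)%R + r (i - 1)%R i <= #|{: chain P i}|)%N /\
    has_dim (order_cohomology k P i)
      (#|{: chain P i}| - (r i (i + 1)%R + r (i - 1)%R i)).
Proof.
move=> dd r; have [rE rE'] : r i (i + 1) = \dim (limg (coboundary k P i (i + 1))) /\
    r (i - 1) i = \dim (limg (coboundary k P (i - 1) i)).
  by rewrite !coboundary_kmap.
have BZ : (limg (coboundary k P (i - 1) i) <= lker (coboundary k P i (i + 1)))%VS.
  by apply/subvP => _ /memv_imgP[f _ ->]; rewrite memv_ker dd.
have dimZ : (\dim (lker (coboundary k P i (i + 1)%R)) + r i (i + 1)%R = #|{: chain P i}|)%N.
  rewrite rE -[in LHS](capfv (lker _)) limg_ker_dim dimvf /dim /=.
  by rewrite muln1.
split; first by rewrite -dimZ addnC leq_add2r rE' dimvS.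
have := has_dim_subquotv (lker (coboundary k P i (i + 1))) (limg (coboundary k P (i - 1) i)).
rewrite (capv_idPr BZ) -rE'; congr has_dim.
by rewrite -dimZ subnDA addnK.
Qed.

Section LargePoset.
Hypothesis P_gt1 : (1 < #|P|)%N.

Let to_set i (c : chain P i) : {set P} := [set x in (val c : seq P)].

Let is_chainE i (s : seq P) : is_chain i s = ((size s)%:Z == i + 1) && strict_chain s.
Proof. by rewrite /is_chain P_gt1. Qed.

Let chainP i (c : chain P i) : strict_chain (val c : seq P) /\ (size (val c))%:Z = i + 1.
Proof.
by have := valP c; rewrite is_chainE => /andP[/eqP -> ->].
Qed.

Let to_set_inj i : injective (@to_set i).
Proof.
move=> c c' cc; apply/val_inj/val_inj; apply: strict_chain_inj => //.
  exact: (chainP c).1.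
exact: (chainP c').1.
Qed.

Let to_set_img i : @to_set i @: setT = graded i.
Proof.
apply/setP => C; apply/imsetP/idP => [[c _ ->]|].
  have [sc cc] := chainP c; rewrite inE strict_chain_in //= -cc /to_set cardsE.
  by rewrite (card_uniqP (strict_chain_uniq sc)).
rewrite inE => /andP[/strict_chain_ex[s ss ->]].
rewrite cardsE (card_uniqP (strict_chain_uniq ss)) => szs.
have szP : (size s <= #|P|)%N.
  by rewrite -(card_uniqP (strict_chain_uniq ss)) max_card.
have sc : is_chain i (Bseq szP).
  by rewrite is_chainE szs ss.
by exists (exist _ (Bseq szP) sc).
Qed.

Let matrixE i i' (c' : chain P i') (c : chain P i) :
  d (to_set c') (to_set c) = coboundary_matrix c' c.
Proof.
rewrite /d -insertion_incidence; [|exact: (chainP c').1|exact: (chainP c).1].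
rewrite /coboundary_matrix /coboundary_chain sum_ffunE; apply: eq_bigr => j _.
rewrite ffunE; congr (_ * _); rewrite sum_ffunE; apply: eq_bigr => y _.
by rewrite ffunE.
Qed.

Let rkE i i' : rk (@coboundary_matrix i i') setT setT = rk d (graded i') (graded i).
Proof.
apply/esym/(@rk_reindex _ _ _ _ _ _ _ _ _ _ _ (@to_set i') (@to_set i)).
- by move=> ? ? _ _; exact: to_set_inj.
- exact: to_set_img.
- by move=> ? ? _ _; exact: to_set_inj.
- exact: to_set_img.
- by move=> ? ? _ _; exact: matrixE.
Qed.

Let card_chain i : #|{: chain P i}| = #|graded i|.
Proof. by rewrite -to_set_img card_imset ?cardsT //; exact: to_set_inj. Qed.

(** The graded coboundaries are the homogeneous pieces of the total one, so
    their composites inherit that they vanish. *)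
Let coboundary_square i (f : cochain k P (i - 1)) :
  coboundary k P i (i + 1) (coboundary k P (i - 1) i f) = 0.
Proof.
rewrite !coboundary_kmap; apply/ffunP => c''; rewrite [RHS]ffunE kmapE inE.
under eq_bigr do rewrite kmapE inE mulr_sumr.
rewrite exchange_big big1 //= => c' _.
under eq_bigr do rewrite mulrA; rewrite -mulr_suml.
rewrite (_ : \sum_(c in setT) _ = 0) ?mul0r //.
(* Evaluating the square of the total map on the indicator of one chain gives
   an entry of the square of its matrix. *)
pose delta : {ffun {set P} -> k^o} := [ffun C : {set P} => (C == to_set c')%:R].
have deltaE C : delta C = (C == to_set c')%:R by rewrite ffunE.
have /ffunP/(_ (to_set c'')) := kmap_chains_square (open_int \top%O) delta.
have gK j (c : chain P j) : to_set c \in graded j by rewrite -to_set_img imset_f.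
have inG j C : (C \in graded j) = (C \in K) && (#|C|%:Z == j + 1) by rewrite inE.
have := gK _ c''; rewrite inG => /andP[c''K szc''].
rewrite [RHS]ffunE kmapE c''K => sum0; rewrite -[RHS]sum0.
rewrite [RHS](bigID (mem (graded i))) /= [X in _ = _ + X]big1 ?addr0; last first.
  move=> C /andP[CK Ci]; have [->|] := eqVneq (incidence k (to_set c'') C) 0.
    by rewrite mul0r.
  case/incidence_neq0 => x xC CE; case/negP: Ci; rewrite /= inG CK /=.
  by move: szc''; rewrite (cardsD1 x) xC -CE PoszD addrC (inj_eq (addIr _)).
rewrite (eq_bigl (mem (@to_set i @: setT))) => [|C]; last first.
  by rewrite /= to_set_img !inG andbA andbb.
rewrite big_imset => [|? ? _ _ /to_set_inj //]; apply: eq_bigr => c _ /=.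
have := gK _ c; rewrite inG => /andP[cK _].
rewrite -!matrixE kmapE cK; congr (_ * _).
rewrite (bigD1 (to_set c')) /= ?deltaE ?eqxx ?mulr1 ?big1 ?addr0 // => [C /andP[_ /negPf CC]|].
  by rewrite deltaE CC mulr0.
by have := gK _ c'; rewrite inG => /andP[].
Qed.

Let card_graded (s : seq int) :
    uniq s -> (forall C, C \in K -> #|C|%:Z - 1 \in s) ->
  (\sum_(i <- s) #|graded i| = #|K|)%N.
Proof.
move=> us Ks; pose q (C : {set P}) := #|C|%:Z - 1.
transitivity (\sum_(i <- s) \sum_(C in K) (q C == i))%N.
  apply: eq_bigr => i _; rewrite -sum1_card -big_mkcondr; apply: eq_bigl => C.
  by rewrite inE /q subr_eq.
rewrite exchange_big -sum1_card; apply: eq_bigr => C CK /=.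
rewrite -(big_mkcond (fun i => q C == i)) sum1_count.
by rewrite (eq_count (eq_sym _)) -[count _ _]/(count_mem _ s) count_uniq_mem // Ks.
Qed.

Let rk_graded (s : seq int) :
    uniq s -> (forall C, C \in K -> #|C|%:Z - 1 \in s) ->
  (\sum_(i <- s) rk d (graded (i + 1)%R) (graded i) = rk d K K)%N.
Proof.
move=> us Ks; rewrite [RHS](rk_classes (p := fun C : {set P} => #|C|%:Z - 2)
    (q := fun C : {set P} => #|C|%:Z - 1) us) //; last first.
  move=> C' C C'K CK; apply: contraNeq => /incidence_neq0[x xC ->].
  by rewrite /= (cardsD1 x C') xC add1n intS; apply/eqP; ring.
apply: eq_bigr => i _; congr rk; apply/setP => C; rewrite !inE ?subr_eq //.
by rewrite -addrA.
Qed.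

(** Every coboundary is outgoing in one degree and incoming in the next, so the
    ranks enter the sum of the dimensions twice. *)
Lemma has_dim_total_large :
  has_dim (total_cohomology k P) (chain_betti k (\top%O : P)).
Proof.
(* A chain of size n has degree n - 1 with 0 <= n <= #|P|; starting at -2 leaves
   room for the shift by one in the incoming ranks. *)
pose s := [seq m%:Z - 2 | m <- iota 0 (#|P| + 3)].
have us : uniq s by rewrite map_inj_uniq ?iota_uniq // => m n /addIr [].
have mems (m : nat) : (m <= #|P| + 2)%N -> m%:Z - 2 \in s.
  by move=> mP; apply: map_f; rewrite mem_iota add0n leq0n /= addnS ltnS.
have cardP (C : {set P}) : (#|C| <= #|P|)%N by exact: max_card.
pose r i := rk d (graded (i + 1)) (graded i).
pose n i := (#|graded i| - (r i + r (i - 1)%R))%N.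
have nP i : (r i + r (i - 1)%R <= #|graded i|)%N /\ has_dim (order_cohomology k P i) (n i).
  have := has_dim_order_cohomology (@coboundary_square i).
  by rewrite /= card_chain !rkE /n /r subrK.
have -> : chain_betti k (\top%O : P) = (\sum_(i <- s) n i)%N.
  rewrite /n sumnB => [|i _]; last by case: (nP i).
  rewrite big_split /= card_graded // => [|C _]; last first.
    have -> : #|C|%:Z - 1 = #|C|.+1%:Z - 2 by rewrite -addn1 PoszD; ring.
    by apply: mems; have := cardP C; lia.
  rewrite rk_graded // => [|C _]; last first.
    have -> : #|C|%:Z - 1 = #|C|.+1%:Z - 2 by rewrite -addn1 PoszD; ring.
    by apply: mems; have := cardP C; lia.
  have -> : (\sum_(i <- s) r (i - 1)%R = \sum_(i <- map (fun i => i - 1)%R s) r i)%N.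
    by rewrite big_map.
  rewrite rk_graded; first by rewrite addnn -mul2n.
    by rewrite map_inj_uniq // => ? ? /addIr.
  move=> C _; apply: map_f; rewrite -[_%:Z](addrK 2).
  rewrite (_ : _ + 2 = (#|C| + 2)%N%:Z) ?PoszD //; apply: mems.
  by have := cardP C; lia.
apply: has_dim_dsum us _ _ => [i|i]; first by case: (nP i).
apply: contraNeq; rewrite /n -lt0n subn_gt0 => h.
have : (0 < #|graded i|)%N by exact: leq_ltn_trans h.
case/card_gt0P => C; rewrite inE => /andP[_ /eqP CE].
have -> : i = #|C|.+1%:Z - 2 by rewrite -addn1 PoszD CE; ring.
by apply: mems; have := cardP C; lia.
Qed.

End LargePoset.

Lemma has_dim_total_cohomology :
  has_dim (total_cohomology k P) (chain_betti k (\top%O : P)).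
Proof.
have [|P_le1] := ltnP 1 #|P|; first exact: has_dim_total_large.
have is_chainE i (s : seq P) : is_chain i s = (i == -2) && nilp s.
  by rewrite /is_chain ltnNge P_le1.
have chainE i (c : chain P i) : i = -2 /\ val c = nil :> seq P.
  by have := valP c; rewrite is_chainE => /andP[/eqP ? /nilP].
have kmap0 i i' f : i != i' -> kmap (@coboundary_matrix i i') setT setT f = 0.
  move=> ii; apply/ffunP => c'; rewrite kmapE inE [RHS]ffunE big1 // => c _.
  by case/eqP: ii; rewrite (chainE _ c).1 (chainE _ c').1.
have rk0 i i' : i != i' -> rk (@coboundary_matrix i i') setT setT = 0%N.
  move=> ii; apply/eqP; rewrite /rk dimv_eq0 -subv0; apply/subvP => _ /memv_imgP[f _ ->].
  by rewrite kmap0 // mem0v.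
have PE (x y : P) : x = y by move: P_le1 => /card_le1_eqP; apply.
have -> : chain_betti k (\top%O : P) = (\sum_(i <- [:: (-2)%R]) #|{: chain P i}|)%N.
  rewrite (PE \top%O \bot%O) chain_betti_bot big_seq1; apply/esym/eqP/fintype1P.
  have c0 : is_chain (-2) ([bseq] : #|P|.-bseq P) by rewrite is_chainE.
  exists (exist _ [bseq] c0) => c; apply/val_inj/val_inj.
  exact: (chainE _ c).2.
apply: has_dim_dsum => // [i|i]; last first.
  rewrite inE => i2; apply: eq_card0 => c.
  by case/eqP: i2; have [] := chainE _ c.
have ii : i != i + 1 by rewrite -subr_eq0 opprD addNKr.
have ii' : i - 1 != i by rewrite -subr_eq0 addrAC subrr.
have := @has_dim_order_cohomology i; rewrite /= !rk0 // subn0; case=> // f.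
by rewrite !coboundary_kmap kmap0.
Qed.

End TotalCohomology.

Lemma chain_betti_lower (k : fieldType) (disp : Order.disp_t)
    (T : finBPOrderType disp) (X : T) :
  chain_betti k (\top%O : lower X) = chain_betti k X.
Proof.
pose e (C : {set lower X}) : {set T} := [set val x | x in C].
have eI : injective e by apply: imset_inj; exact: val_inj.
have eK : e @: chains_in (open_int (\top%O : lower X)) = chains_in (open_int X).
  apply/setP => C; apply/imsetP/idP => [[B /chains_inP[BQ cB] ->]|/chains_inP[CQ cC]].
    apply/chains_inP; split=> [_ /imsetP[x /BQ + ->]|_ _ /imsetP[x xB ->] /imsetP[y yB ->]].
      by rewrite !inE.
    exact: cB.
  exists [set x | val x \in C].
    apply/chains_inP; split=> [x|x y]; rewrite !inE; first by move/CQ; rewrite inE.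
    exact: cC.
  apply/setP => x; apply/idP/imsetP => [xC|[y]]; last by rewrite inE => + ->.
  have xX : (x <= X)%O by have := CQ x xC; rewrite inE => /andP[_ /ltW].
  by exists (exist _ x xX); rewrite ?inE.
rewrite /chain_betti -eK card_imset //; congr (_ - 2 * _)%N.
apply/esym/(@rk_reindex _ _ _ _ _ _ _ _ _ _ _ e e) => // [? ? _ _ /eI //|? ? _ _ /eI //|B' B _ _].
rewrite /incidence big_imset => [|? ? _ _ /val_inj //]; apply: eq_bigr => x xB /=.
congr (_ * _).
  rewrite (_ : e B' :\ val x = e (B' :\ x)) ?(inj_eq eI) //.
  apply/setP => z; rewrite in_setD1; apply/andP/imsetP => [[zx /imsetP[y yB zE]]|[y]].
    by exists y; rewrite // in_setD1 yB andbT; apply: contraNneq zx => <-; rewrite zE.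
  by rewrite in_setD1 => /andP[yx yB] ->; rewrite (inj_eq val_inj) yx imset_f.
rewrite /below_sign; congr (_ ^+ _).
rewrite -(card_imset _ (val_inj : injective (val : lower X -> T))).
congr #|pred_of_set _|; apply/setP => z; rewrite inE.
apply/andP/imsetP => [[/imsetP[y yB ->] yx]|[y]].
  by exists y; rewrite // inE yB.
by rewrite inE => /andP[yB yx] ->; rewrite imset_f.
Qed.

Lemma has_dim_whitney (k : fieldType) (disp : Order.disp_t) (T : finBPOrderType disp) :
  has_dim (whitney_cohomology k T) (\sum_(X : T) chain_betti k X).
Proof.
rewrite -big_enum; apply: has_dim_dsum; first exact: enum_uniq.
  by move=> X; rewrite -chain_betti_lower; exact: has_dim_total_cohomology.
by move=> X; rewrite mem_enum.
Qed.

(** * Faces, flats and the count of chambers *)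

Section Signs.
Variables (R : realType).
Implicit Types a b p q : R.

Lemma sign_of_eq0 a : (sign_of a == Zero) = (a == 0).
Proof. by rewrite /sign_of; case: (eqVneq a 0) => // _; case: ifP. Qed.

Lemma sign_of_gt0 a : (sign_of a == Pos) = (0 < a).
Proof.
by rewrite /sign_of; have [->|_] := eqVneq a 0; [rewrite ltxx | case: ifP].
Qed.

Lemma sign_of_lt0 a : (sign_of a == Neg) = (a < 0).
Proof.
rewrite /sign_of [RHS]lt_neqAle leNgt.
by case: (eqVneq a 0) => // _; case: ifP.
Qed.

Lemma sign_of_comb p q a b : 0 < p -> 0 < q -> sign_of a = sign_of b ->
  sign_of (p * a + q * b) = sign_of a.
Proof.
move=> p0 q0 ab; have [a0|a0|a0] := ltrgt0P a.
- have b0 : 0 < b by rewrite -sign_of_gt0 -ab sign_of_gt0.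
  have /eqP -> : sign_of a == Pos by rewrite sign_of_gt0.
  by apply/eqP; rewrite sign_of_gt0 addr_gt0 ?mulr_gt0.
- have b0 : b < 0 by rewrite -sign_of_lt0 -ab sign_of_lt0.
  have /eqP -> : sign_of a == Neg by rewrite sign_of_lt0.
  apply/eqP; rewrite sign_of_lt0; nra.
- have /eqP b0 : b == 0 by rewrite -sign_of_eq0 -ab sign_of_eq0 a0.
  by rewrite b0 a0 !mulr0 addr0.
Qed.

End Signs.

Section Geometry.
Variables (R : realType) (d : nat) (A : arrangement R d).
Implicit Types (H l : hyperplanes A) (Z : {set hyperplanes A}).
Implicit Types (s : seq (hyperplanes A)) (x y : face A).

Lemma face_of_vector (v : 'rV[R]_d) :
  exists x : face A, forall H, fsign x H = sign_of (form H v : R).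
Proof.
have fv : `[< cell [ffun H : hyperplanes A => sign_of (form H v : R)] !=set0 >]%classic.
  by apply/asboolP; exists v; apply/cellE => H; rewrite ffunE.
by exists (Sub [ffun H => sign_of (form H v : R)] fv) => H; rewrite /fsign ffunE.
Qed.

Lemma vector_of_face x :
  exists v : 'rV[R]_d, forall H, fsign x H = sign_of (form H v : R).
Proof. by have /asboolP[v /cellE xv] := valP x; exists v => H; rewrite xv. Qed.

Lemma mem_hyperplane H (v : 'rV[R]_d) : (v \in val H) = (sign_of (form H v : R) == Zero).
Proof. by rewrite sign_of_eq0 -lker_form memv_ker. Qed.

Definition meet_of Z : {vspace 'rV[R]_d} := (\bigcap_(H in Z) val H)%VS.

Lemma meet_ofP Z (v : 'rV[R]_d) :
  reflect (forall H, H \in Z -> v \in val H) (v \in meet_of Z).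
Proof.
apply: (iffP idP) => [vZ H HZ|vZ]; last first.
  by rewrite memvE; apply/subv_bigcapP => H HZ; rewrite -memvE vZ.
by apply: subvP vZ; exact: bigcapv_inf (subvv _).
Qed.

Lemma meet_ofU1 H Z : meet_of (H |: Z) = (meet_of Z :&: val H)%VS.
Proof.
apply/vspaceP => v; rewrite memv_cap; apply/meet_ofP/andP => [vZ|[/meet_ofP vZ vH] H'].
  split; last by rewrite vZ ?setU11.
  by apply/meet_ofP => H' H'Z; rewrite vZ // setU1r.
by rewrite in_setU1 => /predU1P[->|/vZ].
Qed.

Lemma face_off Z H : ~~ (meet_of Z <= val H)%VS ->
  exists x, {in Z, forall H', fsign x H' = Zero} /\ fsign x H = Pos.
Proof.
case/subvPn => v /meet_ofP vZ; rewrite mem_hyperplane => vH.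
pose w := if 0 < (form H v : R) then v else - v.
have [x xw] := face_of_vector w; exists x; split=> [H' H'Z|].
  rewrite xw; apply/eqP; rewrite -mem_hyperplane /w.
  by case: ifP; rewrite ?memvN => _; exact: vZ.
rewrite xw; apply/eqP; rewrite sign_of_gt0 /w; case: ifP => // vP.
rewrite linearN /= oppr_gt0 lt_neqAle -sign_of_eq0 vH /=.
by rewrite leNgt vP.
Qed.

(** A face inside the intersection of Z off every hyperplane that does not
    contain it: the product of faces is nonzero at H as soon as one factor is,
    so one factor for each such H suffices. *)
Lemma generic_face Z s : exists x, {in Z, forall H, fsign x H = Zero} /\
  {in s, forall H, ~~ (meet_of Z <= val H)%VS -> fsign x H != Zero}.
Proof.
elim: s => [|H s [x [xZ xs]]].
  by exists (face1 A); split=> [H _|//]; rewrite fsign1.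
have [ZH|/face_off[y [yZ yH]]] := boolP (meet_of Z <= val H)%VS.
  exists x; split=> // H'; rewrite inE => /predU1P[->|]; [by rewrite ZH|exact: xs].
exists (face_mul x y); split=> [H' H'Z|H']; first by rewrite fsign_mul xZ ?yZ.
rewrite inE fsign_mul => /predU1P[->|H's /(xs _ H's)]; last by case: (fsign x H').
by rewrite yH; case: (fsign x H).
Qed.

Lemma flat_meet Z : exists X : lattice A, val X = meet_of Z.
Proof.
have [x [xZ xs]] := generic_face Z (enum {: hyperplanes A}).
exists (flat_of x); apply/eqP; rewrite eqEsubv; apply/andP; split.
  by apply/subv_bigcapP => H HZ; apply: bigcapv_inf (subvv _); rewrite xZ.
apply/subv_bigcapP => H; apply: contraTT => ZH.
by apply: xs; rewrite ?mem_enum.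
Qed.

Lemma flatE (X : lattice A) : val X = meet_of [set H | (val X <= val H)%VS].
Proof.
have /codomP[x xE] := valP X; apply/eqP; rewrite eqEsubv; apply/andP; split.
  by apply/subv_bigcapP => H; rewrite inE.
rewrite {2}xE; apply/subv_bigcapP => H xH; apply: bigcapv_inf (subvv _).
by rewrite inE xE; exact: bigcapv_inf (subvv _).
Qed.

(** The faces inside the intersection of Z that lie in a region of the
    arrangement s; a region of the restriction is identified with the signs of
    such a face on s. *)
Definition faces_over Z s : {set face A} :=
  [set x | [forall H in Z, fsign x H == Zero] && all (fun H => fsign x H != Zero) s].

Definition restrict s x : {ffun hyperplanes A -> sign} :=
  [ffun H => if H \in s then fsign x H else Zero].

Definition patterns Z s := restrict s @: faces_over Z s.

Lemma restrictP s x y : restrict s x = restrict s y <-> {in s, fsign x =1 fsign y}.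
Proof.
split=> [/ffunP xy H Hs|xy]; last by apply/ffunP => H; rewrite !ffunE; case: ifP => // /xy.
by have := xy H; rewrite !ffunE Hs.
Qed.

Lemma faces_overP Z s x :
  reflect ({in Z, forall H, fsign x H = Zero} /\ {in s, forall H, fsign x H != Zero})
    (x \in faces_over Z s).
Proof.
rewrite inE; apply: (iffP andP) => [[/forall_inP xZ /allP xs]|[xZ xs]].
  by split=> // H /xZ/eqP.
by split; [apply/forall_inP => H /xZ/eqP|apply/allP].
Qed.

(** A region is convex: the segment between points on the two sides of l stays
    in the region and crosses l. *)
Lemma elimination Z s l x y :
    x \in faces_over Z s -> y \in faces_over Z s -> restrict s x = restrict s y ->
    fsign x l = Pos -> fsign y l = Neg ->
  exists2 w, w \in faces_over (l |: Z) s & restrict s w = restrict s x.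
Proof.
move=> /faces_overP[xZ xs] /faces_overP[yZ _] /restrictP xy xl yl.
have [u uE] := vector_of_face x; have [v vE] := vector_of_face y.
have p0 : 0 < (form l u : R) by rewrite -sign_of_gt0 -uE xl.
have q0 : 0 < - (form l v : R) by rewrite oppr_gt0 -sign_of_lt0 -vE yl.
have [w wE] := face_of_vector (- (form l v : R) *: u + (form l u : R) *: v).
have {}wE H : fsign w H = sign_of (- (form l v : R) * (form H u : R) + (form l u : R) * (form H v : R)).
  by rewrite wE linearD !linearZ.
have ws : {in s, fsign w =1 fsign x}.
  by move=> H Hs; rewrite wE sign_of_comb // -?uE // -vE xy.
exists w; last exact/restrictP.
apply/faces_overP; split=> [H|H Hs]; last by rewrite ws // xs.
rewrite in_setU1 wE => /predU1P[->|HZ].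
  by apply/eqP; rewrite sign_of_eq0 mulNr mulrC addNr.
by rewrite sign_of_comb // -?uE ?xZ // -vE yZ.
Qed.

Lemma face_opp x : exists y, forall H,
  fsign y H = match fsign x H with Pos => Neg | Neg => Pos | Zero => Zero end.
Proof.
have [v vE] := vector_of_face x; have [y yE] := face_of_vector (- v).
exists y => H; rewrite yE vE linearN /= /sign_of oppr_eq0 oppr_gt0.
by case: ltrgt0P.
Qed.

(** From a point of l in the interior of a region, a small step inside the
    intersection of Z leads to either side of l without leaving the region; the
    small step is the product with a face on the desired side. *)
Lemma perturbation Z s l w e : e != Zero -> ~~ (meet_of Z <= val l)%VS ->
    w \in faces_over (l |: Z) s ->
  exists2 x, x \in faces_over Z s /\ fsign x l = e & restrict s x = restrict s w.
Proof.
move=> e0 Zl /faces_overP[wZ ws].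
have [z [zZ zl]] : exists z, {in Z, forall H, fsign z H = Zero} /\ fsign z l = e.
  have [z [zZ zl]] := face_off Zl; case: e e0 => // _; first by exists z.
  have [y yE] := face_opp z; exists y; by split=> [H HZ|]; rewrite yE ?zl // zZ.
have sg H : H \in s -> fsign (face_mul w z) H = fsign w H.
  by move=> /ws; rewrite fsign_mul; case: (fsign w H).
exists (face_mul w z); last exact/restrictP.
split; last by rewrite fsign_mul wZ ?setU11.
apply/faces_overP; split=> [H HZ|H Hs]; last by rewrite sg // ws.
by rewrite fsign_mul wZ ?zZ // setU1r.
Qed.

(** Deletion-restriction.  The regions after adding l are the regions reaching
    to the positive side of l and those reaching to the negative side; every
    old region is of one of the two kinds, and those of both kinds are the ones
    that l cuts. *)
Lemma card_patterns_cons Z l s : l \notin s ->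
  #|patterns Z (l :: s)| =
  if (meet_of Z <= val l)%VS then 0%N
  else (#|patterns Z s| + #|patterns (l |: Z) s|)%N.
Proof.
move=> ls; case: ifPn => Zl.
  apply: eq_card0 => t; apply/negP => /imsetP[x /faces_overP[xZ xs] _].
  have [v vE] := vector_of_face x; have /negP := xs l (mem_head _ _).
  rewrite vE -mem_hyperplane; case; apply: (subvP Zl); apply/meet_ofP => H HZ.
  by rewrite mem_hyperplane -vE xZ.
pose B e := restrict s @: [set x in faces_over Z s | fsign x l == e].
pose ext e (t : {ffun hyperplanes A -> sign}) :=
  [ffun H => if H == l then e else t H].
have extE e x : fsign x l = e -> ext e (restrict s x) = restrict (l :: s) x.
  move=> xl; apply/ffunP => H; rewrite !ffunE inE.
  by case: eqP => [->|] //=.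
pose D e := [set t in patterns Z (l :: s) | t l == e].
have cardB e : e != Zero -> #|D e| = #|B e|.
  move=> e0; rewrite -(card_in_imset (f := ext e) (D := mem (B e))); last first.
    move=> _ _ /imsetP[x _ ->] /imsetP[y _ ->] /ffunP xy.
    apply/ffunP => H; have := xy H; rewrite !ffunE; case: eqP => // -> _.
    by rewrite (negPf ls).
  apply: eq_card => t; rewrite [t \in D _]inE.
  apply/andP/imsetP => [[]|[_ /imsetP[x + ->] ->]].
    case/imsetP=> x /faces_overP[xZ xs] -> /eqP; rewrite ffunE mem_head => xl.
    exists (restrict s x); last by rewrite extE.
    apply: imset_f; rewrite inE xl eqxx andbT; apply/faces_overP.
    by split=> // H Hs; rewrite xs // inE Hs orbT.
  rewrite inE => /andP[/faces_overP[xZ xs] /eqP xl]; rewrite extE //.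
  rewrite ffunE mem_head xl eqxx; split=> //; apply/imset_f/faces_overP.
  by split=> // H; rewrite inE => /predU1P[->|/xs]; rewrite ?xl.
have -> : #|patterns Z (l :: s)| = (#|B Pos| + #|B Neg|)%N.
  rewrite -!cardB //.
  have D0 : D Pos :&: D Neg = set0.
    apply/setP => t; rewrite in_setI in_set0 [t \in D Pos]inE [t \in D Neg]inE.
    by apply/negP => /andP[/andP[_ /eqP ->] /andP[]].
  have DU : patterns Z (l :: s) = D Pos :|: D Neg.
    apply/setP => t; rewrite in_setU [t \in D Pos]inE [t \in D Neg]inE -andb_orr.
    apply/idP/andP => [tP|[]//]; split=> //; case/imsetP: tP => x /faces_overP[_ xs] ->.
    by have := xs l (mem_head _ _); rewrite ffunE mem_head; case: (fsign x l).
  by rewrite DU cardsU D0 cards0 subn0.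
rewrite -cardsUI; congr (_ + _)%N; apply: eq_card => t.
  rewrite in_setU; apply/orP/imsetP => [[/imsetP[x]|/imsetP[x]]|[x xF ->]].
  - by rewrite inE => /andP[xF _] ->; exists x.
  - by rewrite inE => /andP[xF _] ->; exists x.
  case xl: (fsign x l).
  - by left; apply: imset_f; rewrite inE xF xl.
  - by right; apply: imset_f; rewrite inE xF xl.
  have xF' : x \in faces_over (l |: Z) s.
    case/faces_overP: xF => xZ xs; apply/faces_overP; split=> // H.
    by rewrite in_setU1 => /predU1P[->|/xZ].
  have [y [yF yl] <-] := perturbation (e := Pos) isT Zl xF'.
  by left; apply: imset_f; rewrite inE yF yl.
rewrite in_setI; apply/andP/imsetP => [[/imsetP[x + ->] /imsetP[y + xy]]|[w wF ->]].
  rewrite inE => /andP[xF /eqP xl]; rewrite inE => /andP[yF /eqP yl].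
  by have [w wF wx] := elimination xF yF xy xl yl; exists w.
have [x [xF xl] xw] := perturbation (e := Pos) isT Zl wF.
have [y [yF yl] yw] := perturbation (e := Neg) isT Zl wF.
by split; [rewrite -xw|rewrite -yw]; apply: imset_f; rewrite inE ?xF ?xl ?yF ?yl.
Qed.

End Geometry.

Section Counting.
Variables (R : realType) (d : nat) (A : arrangement R d).
Implicit Types (H l a : hyperplanes A) (Z : {set hyperplanes A}).
Implicit Types (s : seq (hyperplanes A)) (x : face A) (X Y : lattice A).
Implicit Types (W : {vspace 'rV[R]_d}).

(** The number of subsets t of s whose intersection with W is X and such that
    no member l of s contains the intersection of W with the members of t
    preceding l.  For W the whole space these are the sets without broken
    circuits: each choice is whether l is taken, and no choice is left when the
    subspace cut out so far lies in l. *)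
Fixpoint nbc s W X : nat :=
  if s is l :: s' then
    if (W <= val l)%VS then 0%N else (nbc s' W X + nbc s' (W :&: val l)%VS X)%N
  else W == val X.

Lemma card_patterns Z s : uniq s ->
  #|patterns Z s| = (\sum_X nbc s (meet_of Z) X)%N.
Proof.
elim: s Z => [|l s IHs] Z /=.
  move=> _; have [X XE] := flat_meet Z; rewrite (bigD1 X) //= XE eqxx big1 => [|Y YX].
    rewrite addn0; apply/eqP/cards1P; exists [ffun=> Zero].
    apply/setP => t; rewrite in_set1; apply/imsetP/eqP => [[x _ ->]|->].
      by apply/ffunP => H; rewrite !ffunE.
    exists (face1 A); last by apply/ffunP => H; rewrite !ffunE.
    by apply/faces_overP; split=> // H _; exact: fsign1.
  by rewrite -XE (inj_eq val_inj) eq_sym (negPf YX).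
case/andP => ls us; rewrite card_patterns_cons //; case: ifP => [_|Zl].
  by rewrite big1.
by rewrite big_split /= !IHs // meet_ofU1.
Qed.

Lemma nbc_notin s W X : ~~ (val X <= W)%VS -> nbc s W X = 0%N.
Proof.
elim: s W => [|l s IHs] W XW /=; first by case: eqP XW => // ->; rewrite subvv.
case: ifP => // _; rewrite !IHs //; apply: contra XW => /subv_trans; apply.
exact: capvSl.
Qed.

Lemma nbc_free s W X : (val X <= W)%VS -> {in s, forall l, ~~ (val X <= val l)%VS} ->
  nbc s W X = (W == val X).
Proof.
elim: s W => [|l s IHs] W XW sX //=.
have Xl := sX l (mem_head _ _).
have -> : (W <= val l)%VS = false.
  by apply/negP => /(subv_trans XW); exact/negP.
rewrite IHs // => [|l' l's]; last by rewrite sX // inE l's orbT.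
rewrite nbc_notin ?addn0 //; apply: contra Xl => /subv_trans; apply.
exact: capvSr.
Qed.

(** The choices made along s lead to a flat Y, from which the choices along t
    lead to X. *)
Lemma nbc_cat s t Z X :
  nbc (s ++ t) (meet_of Z) X = (\sum_Y nbc s (meet_of Z) Y * nbc t (val Y) X)%N.
Proof.
elim: s Z => [|l s IHs] Z /=.
  have [Y YE] := flat_meet Z; rewrite (bigD1 Y) //= YE eqxx mul1n big1 ?addn0 // => Y' Y'Y.
  by rewrite -YE (inj_eq val_inj) eq_sym (negPf Y'Y).
case: ifP => _; first by rewrite big1.
rewrite -meet_ofU1 !IHs -big_split; apply: eq_bigr => Y _ /=.
by rewrite mulnDl.
Qed.

Lemma meet_of0 : meet_of (set0 : {set hyperplanes A}) = fullv.
Proof. by rewrite /meet_of big_set0. Qed.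

(** A set without broken circuits that meets in X contains the last hyperplane
    a through X: otherwise a would contain the intersection of the members
    preceding it.  Removing a leaves a set of the same kind meeting in a flat Y
    that is not in a and whose intersection with a is X, and a can be put back
    because it comes after all the hyperplanes through Y. *)
Lemma nbc_last s t a X : (val X <= val a)%VS ->
    {in t, forall l, ~~ (val X <= val l)%VS} ->
  nbc (s ++ a :: t) fullv X =
  (\sum_(Y | ~~ (val Y <= val a)%VS && ((val Y :&: val a)%VS == val X))
     nbc (s ++ a :: t) fullv Y)%N.
Proof.
move=> Xa tX; rewrite -meet_of0 nbc_cat [RHS]big_mkcond; apply: eq_bigr => Y _ /=.
case: ifP => [|Ya] /=; first by rewrite muln0.
have [YaX|YaX] := eqVneq (val Y :&: val a)%VS (val X); last first.
  have [XY|XY] := boolP (val X <= val Y)%VS; last first.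
    have XYa : ~~ (val X <= val Y :&: val a)%VS by rewrite subv_cap negb_and XY.
    by rewrite (nbc_notin t XY) (nbc_notin t XYa) muln0.
  have XYa : (val X <= val Y :&: val a)%VS by rewrite subv_cap XY.
  rewrite (nbc_free XY tX) (nbc_free XYa tX) (negPf YaX) addn0; case: eqP => [YX|]; rewrite ?muln0 //.
  by rewrite YX Xa in Ya.
have XY : (val X <= val Y)%VS by rewrite -YaX capvSl.
have XYa : (val X <= val Y :&: val a)%VS by rewrite YaX.
rewrite (nbc_free XY tX) (nbc_free XYa tX) YaX eqxx addn1.
have -> : (val Y == val X) = false by apply/eqP => YX; rewrite YX Xa in Ya.
rewrite muln1 nbc_cat (bigD1 Y) //= Ya.
have YaY : ~~ (val Y <= val Y :&: val a)%VS by rewrite subv_cap subvv Ya.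
have tY : {in t, forall l, ~~ (val Y <= val l)%VS}.
  by move=> l /tX; apply: contra; exact: subv_trans.
rewrite (nbc_free (subvv _) tY) eqxx (nbc_notin t YaY) addn0 muln1 big1 ?addn0 // => Y' Y'Y.
case: ifP => _; rewrite ?muln0 // [nbc t (_ :&: _)%VS _]nbc_notin; last first.
  by rewrite subv_cap Ya andbF.
have [YY'|YY'] := boolP (val Y <= val Y')%VS; last by rewrite (nbc_notin t YY') muln0.
by rewrite (nbc_free YY' tY) (inj_eq val_inj) (negPf Y'Y) muln0.
Qed.

Lemma card_chambers :
  #|[set c : face A | is_chamber c]| = (\sum_X nbc (enum {: hyperplanes A}) fullv X)%N.
Proof.
rewrite -meet_of0 -card_patterns ?enum_uniq // /patterns card_in_imset.
  apply: eq_card => c; rewrite inE; apply/forallP/faces_overP => [cH|[_ cH] H].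
    by split=> // H; rewrite in_set0.
  by rewrite cH ?mem_enum.
move=> x y _ _ /restrictP xy; apply: faceP => H.
by rewrite xy ?mem_enum.
Qed.

Section Betti.
Variable k : fieldType.
Let T : finBPOrderType _ := (lattice A)^d.

Lemma le_dualE (X Y : T) : (X <= Y)%O = (val (Y : lattice A) <= val (X : lattice A))%VS.
Proof. by []. Qed.

Lemma dim_meet_hyperplane (U : {vspace 'rV[R]_d}) a :
  (\dim U <= (\dim (U :&: val a)).+1)%N.
Proof.
rewrite -(leq_add2r (\dim (val a))) -dimv_sum_cap addSnnS dim_hyperplane addnC.
by rewrite leq_add2l; have := dimvS (subvf (U + val a)%VS); rewrite dimvf /dim /= mul1n.
Qed.

(** In the opposite lattice the join with the hyperplane a is the intersection
    with a.  It lowers the dimension by at most one, so a flat Y with Y cap a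
    equal to X has no flat strictly between X and itself. *)
Lemma chain_betti_recursion (X : lattice A) a : (val X <= val a)%VS ->
  chain_betti k (X : T) =
  (\sum_(Y | ~~ (val Y <= val a)%VS && ((val Y :&: val a)%VS == val X))
     chain_betti k (Y : T))%N.
Proof.
move=> Xa.
have [al alE] : exists Y : lattice A, val Y = val a.
  by have [Y YE] := flat_meet [set a]; exists Y; rewrite YE /meet_of big_set1.
have jE (Y : lattice A) : exists Y' : lattice A, val Y' = (val Y :&: val a)%VS.
  have [Y' Y'E] := flat_meet (a |: [set H | (val Y <= val H)%VS]).
  by exists Y'; rewrite Y'E meet_ofU1 -flatE.
have [j {}jE] := choice jE.
rewrite (@chain_betti_complements k _ T al X j).
- apply: eq_bigl => Y; rewrite inE le_dualE le_dualE alE -(inj_eq val_inj) jE.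
  case: (boolP (val Y <= val a)%VS) => /= Ya; first by rewrite andbF.
  by rewrite andbT; case: eqP => [<-|]; rewrite ?capvSl ?andbF.
- by move=> Y Z; rewrite !le_dualE jE alE subv_cap.
- rewrite lt_neqAle le0x andbT; apply/eqP => al0.
  have : (fullv <= val a)%VS.
    have [Y YE] := flat_meet (set0 : {set hyperplanes A}); have := @le0x _ T Y.
    by rewrite le_dualE al0 alE YE meet_of0.
  move=> /dimvS; rewrite dimvf /dim /= mul1n -[X in (X <= _)%N](dim_hyperplane a).
  by rewrite ltnn.
- by rewrite le_dualE alE.
move=> Y Z; rewrite inE => /andP[_ /eqP jY] YZ; apply/negP => ZX.
have lt_dim (U V : T) : (U < V)%O -> (\dim (val (V : lattice A)) < \dim (val (U : lattice A)))%N.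
  rewrite lt_neqAle le_dualE => /andP[UV VU]; rewrite ltn_neqAle dimvS // andbT.
  apply: contra UV => VUd; apply/eqP/val_inj/eqP.
  rewrite eq_sym eqEdim; apply/andP; split; first exact: VU.
  by apply: eq_leq; exact/esym/eqP.
have := leq_trans (lt_dim _ _ YZ) (dim_meet_hyperplane (val (Y : lattice A)) a).
by rewrite -jE jY ltnS leqNgt lt_dim.
Qed.

(** The two sides satisfy the same recursion, provided that the hyperplane in
    it is the last one containing X. *)
Lemma chain_betti_nbc (X : lattice A) :
  chain_betti k (X : T) = nbc (enum {: hyperplanes A}) fullv X.
Proof.
have [n] := ubnP (d - \dim (val X))%N; elim: n X => // n IHn X /ltnSE dX.
have [/hasP[a0 _ Xa0]|/hasPn sX] :=
  boolP (has (fun H => val X <= val H)%VS (enum {: hyperplanes A})); last first.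
  have XE : val X = fullv.
    rewrite flatE /meet_of big1 // => H; rewrite inE => XH.
    by have := sX H (mem_enum _ _); rewrite XH.
  rewrite nbc_free ?subvf // XE eqxx.
  have -> : X = \bot%O :> T.
    by apply/eqP; rewrite eq_le le0x andbT le_dualE XE subvf.
  exact: chain_betti_bot.
have [a Xa [s [t [sE tX]]]] : exists2 a, (val X <= val a)%VS & exists s t,
    enum {: hyperplanes A} = s ++ a :: t /\ {in t, forall l, ~~ (val X <= val l)%VS}.
  have: has (fun H => val X <= val H)%VS (enum {: hyperplanes A}).
    by apply/hasP; exists a0; rewrite ?mem_enum.
  elim/last_ind: (enum _) => // r b IHr; rewrite has_rcons.
  have [Xb _|Xb /= /IHr[a Xa [s [t [-> tX]]]]] := boolP (val X <= val b)%VS.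
    by exists b => //; exists r, [::]; rewrite cats1.
  exists a => //; exists s, (rcons t b); rewrite rcons_cat; split=> // l.
  by rewrite mem_rcons inE => /predU1P[->|/tX].
rewrite (chain_betti_recursion Xa) sE nbc_last // -sE; apply: eq_bigr => Y /andP[Ya /eqP YX].
apply: IHn; apply: leq_trans dX.
have XY : (val X <= val Y)%VS by rewrite -YX capvSl.
have : (\dim (val X) < \dim (val Y))%N.
  rewrite ltn_neqAle dimvS // andbT; apply: contra Ya => XYd.
  have XYv : val X = val Y.
    by apply/eqP; rewrite eqEdim XY /=; apply: eq_leq; exact/esym/eqP.
  by move: Xa; rewrite XYv.
have := dimvS (subvf (val Y)); rewrite dimvf /dim /= mul1n.
by lia.
Qed.

Lemma card_chambers_betti :
  #|[set c : face A | is_chamber c]| = (\sum_(X : T) chain_betti k X)%N.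
Proof. by rewrite card_chambers; apply: eq_bigr => X _; rewrite -chain_betti_nbc. Qed.

End Betti.
End Counting.

(** * The ideal of chambers *)

Section Ideal.
Variables (k : fieldType) (R : realType) (d : nat) (A : arrangement R d).

Lemma has_dim_chamber_space :
  has_dim (chamber_space k A) #|[set c : face A | is_chamber c]|.
Proof.
rewrite cardE.
apply: (@has_dim_coords _ _ _ _ (fun u c => (val u : {malg k[face A]})@_c)).
- exact: enum_uniq.
- by move=> a u v c /=; rewrite mcoeffD mcoeffZ.
- move=> u u0; apply/val_inj/malgP => x /=; rewrite mcoeff0.
  have [xc|xc] := boolP (is_chamber x); first by rewrite u0 // mem_enum inE.
  by have /chamber_idealP -> := valP u.
move=> phi; pose m : {malg k[face A]} := \sum_(c | is_chamber c) phi c *: << c >>.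
have mI : m \in @chamber_ideal k R d A by apply/asboolP; exists phi.
have mE c : is_chamber c -> m@_c = phi c.
  move=> cc; rewrite /m raddf_sum (eq_bigr (fun x => phi x * (x == c)%:R)); last first.
    by move=> x _; rewrite /= mcoeffZ mcoeffU.
  rewrite (bigD1 c) // eqxx mulr1.
  rewrite big1 => [|x /andP[_ /negPf ->]]; last by rewrite mulr0.
  exact: addr0.
by exists (exist _ m mI) => c; rewrite mem_enum inE => /mE.
Qed.

Lemma chamber_mulr (c x : face A) : is_chamber c -> face_mul c x = c.
Proof.
by move=> /forallP cc; apply: faceP => H; rewrite fsign_mul; have := cc H; case: (fsign c H).
Qed.

Lemma mul_face (x y : face A) :
  << x >> * << y >> = << face_mul x y >> :> {malg k[face A]}.
Proof. by rewrite malgM_def fgmulUU mulr1. Qed.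

Lemma scale_face (z : k) (x : face A) : z *: << x >> = << z *g x >> :> {malg k[face A]}.
Proof. by rewrite -mul_malgC malgM_def fgmulUU mulr1 mul1m. Qed.

Lemma mul_faceZ (z : k) (x y : face A) :
  << x >> * (z *: << y >>) = z *: << face_mul x y >> :> {malg k[face A]}.
Proof.
have e : << x >> * << z *g y >> = << z *g face_mul x y >> :> {malg k[face A]}.
  by rewrite malgM_def fgmulUU mul1r.
exact: etrans (congr1 (fun m => << x >> * m) (scale_face z y))
              (etrans e (esym (scale_face z _))).
Qed.

Lemma chamber_ideal_mulr_chamber (m : {malg k[face A]}) (c : face A) :
  m \in @chamber_ideal k R d A -> m * << c >> = m.
Proof.
move=> /asboolP[z ->]; rewrite mulr_suml; apply: eq_bigr => x xc.
by rewrite -scalerAl mul_face chamber_mulr.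
Qed.

(** Since c x = c for every x, multiplication by c on the left only retains the
    sum of the coefficients. *)
Lemma chamber_mul_ideal (m : {malg k[face A]}) (c : face A) :
    is_chamber c -> m \in @chamber_ideal k R d A ->
  exists z : k, << c >> * m = z *: << c >>.
Proof.
move=> cc /asboolP[z ->]; exists (\sum_(x | is_chamber x) z x).
rewrite mulr_sumr scaler_suml; apply: eq_bigr => x xc.
by rewrite mul_faceZ chamber_mulr.
Qed.

Lemma chamber_in_ideal (c : face A) : is_chamber c ->
  (<< c >> : {malg k[face A]}) \in @chamber_ideal k R d A.
Proof.
move=> cc; apply/chamber_idealP => x xc; rewrite mcoeffU.
by case: eqP xc => // <-; rewrite cc.
Qed.

Let S : nzRingType := {malg k[face A]}.
Let M : lmodType S := chamber_module k A.

Let gen (c : face A) (cc : is_chamber c) : M :=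
  exist _ (<< c >> : S) (chamber_in_ideal cc).

Let val_scale (a : S) (m : M) : val (a *: m) = a * (val m : S).
Proof. by []. Qed.

Let genE c (cc : is_chamber c) (m : M) : m = (val m : S) *: gen cc.
Proof.
apply: val_inj; rewrite val_scale; apply/esym/chamber_ideal_mulr_chamber.
exact: (valP m).
Qed.

(** The module is generated by c subject to m = m c, so a map out of it is
    lifted by lifting the image of c. *)
Theorem chamber_module_projective : projective (chamber_module k A).
Proof.
have [c cc] := exists_chamber A.
move=> U V g f gsurj; have [u0 u0E] := gsurj (f (gen cc)).
pose h (m : M) : U := (val m : S) *: u0.
have hlin : linear h by move=> a m m'; rewrite /h scalerA -scalerDl.
pose hL := GRing.isLinear.Build S M U *:%R h hlin.
pose H : {linear M -> U} := HB.pack h hL.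
exists H => m; rewrite {2}(genE cc m) [RHS]linearZ /= /h -u0E.
by rewrite linearZ.
Qed.

(** Writing c = u + v along a decomposition, one of u and v has nonzero
    coefficient sum; its product with c is a nonzero multiple of c, so that
    summand contains the generator c. *)
Theorem chamber_module_indecomposable : indecomposable (chamber_module k A).
Proof.
have [c cc] := exists_chamber A.
split.
  exists (gen cc); apply/eqP => /(congr1 val) /= c0.
  have := monalgU_eq0 (1 : k) c; rewrite c0 eqxx oner_eq0.
  by [].
have trivial_compl (U V : submodClosed M) (u : M) z :
    (forall m, m \in U -> m \in V -> m = 0) -> u \in U ->
    << c >> * (val u : S) = z *: << c >> -> z != 0 -> forall m, m \in V -> m = 0.
  move=> UV uU uE z0 m mV; apply: (UV m _ mV); rewrite (genE cc m).
  have zE : (z^-1)%:MP * (<< c >> * (val u : S)) = << c >>.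
    by rewrite mul_malgC uE scalerA (mulVf z0) scale1r.
  have -> : gen cc = (z^-1)%:MP *: ((<< c >> : S) *: u).
    by apply: val_inj; exact: esym zE.
  by rewrite !rpredZ.
move=> U V UV_sum UV_cap; have [u [v [uU vV eE]]] := UV_sum (gen cc).
have [zu zuE] := chamber_mul_ideal cc (valP u).
have [zv zvE] := chamber_mul_ideal cc (valP v).
have [zu0|zu0] := eqVneq zu 0; last by right; exact: trivial_compl UV_cap uU zuE zu0.
left; apply: (trivial_compl V U v zv) => //; first by move=> m mV mU; exact: UV_cap.
apply: contra_eq_neq zvE => ->; rewrite scale0r.
have -> : val v = (<< c >> : S) - val u.
  have := congr1 val eE. by move=> /= ->; rewrite addrC addKr.
rewrite mulrBr zuE zu0 scale0r subr0 mul_face chamber_mulr //.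
by rewrite monalgU_eq0 oner_eq0.
Qed.

End Ideal.

Theorem corollary10p6 (k : fieldType) (R : realType) (d : nat)
    (A : arrangement R d) :
  (exists f : {linear whitney_cohomology k (lattice A)^d -> chamber_space k A},
     bijective f) /\
  projective (chamber_module k A) /\
  indecomposable (chamber_module k A).
Proof.
split; last split.
- apply: has_dim_iso (has_dim_whitney k (lattice A)^d) _.
  by rewrite -card_chambers_betti; exact: has_dim_chamber_space.
- exact: chamber_module_projective.
- exact: chamber_module_indecomposable.
Qed.
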